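(* Let $p\in(0,1/2]$ with $pn$ an integer. Let $f\in\mathbb{R}[x_1,\dots,x_n]$ be a multilinear polynomial depending on $d$ variables, and let $\tilde f$ be the unique harmonic multilinear polynomial agreeing with $f$ on $\binom{[n]}{pn}$, where $d\le pn\le n/2$. For $\pi\in\{\mu_p,\mathcal{G}_p\}$ we have $$\|f-\tilde f\|_\pi^2=O\left(\frac{d^22^d}{p(1-p)n}\right)\|f\|_\pi^2 .$$
   Context: $[n]=\{1,\dots,n\}$. The slice is $\binom{[n]}{k}=\{x\in\{0,1\}^n: x_1+\cdots+x_n=k\}$. $\mu_p$ is the product distribution on $\{0,1\}^n$ with marginals $\mathrm{Ber}(p)$, and $\mathcal{G}_p$ is the Gaussian measure $\mathrm{N}((p,\dots,p),p(1-p)I_n)$ on $\mathbb{R}^n$. $\|g\|_\pi=\sqrt{\mathbb{E}_\pi[g^2]}$. A polynomial is multilinear if $\partial^2 f/\partial x_i^2=0$ for all $i$, and harmonic if $\sum_{i=1}^n\partial f/\partial x_i=0$. Every function on $\binom{[n]}{k}$ is represented by a unique harmonic multilinear polynomial of degree at most $\min(k,n-k)$; this is the meaning of ''the unique harmonic multilinear polynomial agreeing with $f$ on the slice''. $O(\cdot)$ hides an absolute constant (with the underlying limit $n\to\infty$). *)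

(* Defs.v *)
From HB Require Import structures.
From mathcomp Require Import all_boot all_order all_algebra.
(* The notations of mpoly clash with those of the analysis libraries, so mpoly
   is imported without them. *)
From mathcomp Require Import -(notations) mpoly.
From mathcomp Require Import all_classical all_reals all_analysis.

Set Implicit Arguments.
Unset Strict Implicit.
Unset Printing Implicit Defensive.

Import Order.TTheory GRing.Theory Num.Theory.
Import numFieldNormedType.Exports.

Local Open Scope classical_set_scope.
Local Open Scope ring_scope.

Notation "{ 'mpoly' T [ n ] }" := (mpoly.mpoly n T)
  (at level 0, T, n at level 2, format "{ 'mpoly'  T [ n ] }") : type_scope.

Section Polynomials.
Context {R : realType} {n : nat}.
Implicit Types f g : {mpoly R[n]}.

Definition multilinear f := forall i : 'I_n, mderiv i (mderiv i f) = 0.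

Definition harmonic f := \sum_(i < n) mderiv i f = 0.

Definition occurring_vars f : {set 'I_n} :=
  finset (fun i : 'I_n =>
    has (fun m : multinom n => m i != 0%N) (msupp f)).

Definition eval_at f (x : n.-tuple R) : R := meval (tnth x) f.

(* A point of the cube {0,1}^n is an n.-tuple bool. *)
Definition eval_at_cube f (x : n.-tuple bool) : R :=
  meval (fun i => (tnth x i)%:R) f.

Definition slice k : set (n.-tuple bool) :=
  [set x : n.-tuple bool | (\sum_(i < n) tnth x i = k)%N].

(* [g] represents, on the [k]-th slice, the function induced by [f]. The degree
   bound is what makes the representative unique; since [mpoly.msize g] is one
   more than the degree of [g], it reads deg g <= min (k, n - k). *)
Definition harmonic_representative k f g :=
  [/\ multilinear g,
      harmonic g,
      (mpoly.msize g <= (minn k (n - k)).+1)%N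
    & forall x, slice k x -> eval_at_cube f x = eval_at_cube g x].

End Polynomials.

Section PowerMeasure.
Context {d} {T : measurableType d} {R : realType}.
Variable P : probability T R.

Definition tuple_cons m (x : T * m.-tuple T) : m.+1.-tuple T :=
  [tuple of x.1 :: x.2].

Lemma measurable_tuple_cons m : measurable_fun setT (@tuple_cons m).
Proof.
exact: (measurable_cons (@measurable_fst _ _ _ _) (@measurable_snd _ _ _ _)).
Qed.

HB.instance Definition _ m :=
  isMeasurableFun.Build _ _ _ _ (@tuple_cons m) (@measurable_tuple_cons m).

(* The law of m independent samples of [P], i.e. the m-fold product measure. *)
Fixpoint power_prob m : probability (m.-tuple T) R :=
  if m is m'.+1 then distribution (P \x power_prob m')%E (@tuple_cons m')
  else \d_([tuple] : 0.-tuple T).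

Lemma power_prob_box m (A : 'I_m -> set T) : (forall i, measurable (A i)) ->
  power_prob m [set x | forall i, A i (tnth x i)] = (\prod_(i < m) P (A i))%E.
Proof.
elim: m A => [|m IH] A mA /=.
  rewrite big_ord0 diracE mem_set//= => -[]//.
rewrite big_ord_recl -IH// /distribution /pushforward /=.
rewrite -[RHS]product_measure1E//.
- congr ((_ \x _)%E _); apply/seteqP; split => -[a x] /=.
    move=> H; split; first by have := H ord0.
    by move=> i; have := H (lift ord0 i); rewrite tnthS.
  move=> [Ha Hx] i; case: (unliftP ord0 i) => [j|] ->; last exact: Ha.
  by rewrite tnthS; exact: Hx.
- rewrite (_ : [set x | _] =
    \bigcap_(i in [set: 'I_m]) ((fun x : m.-tuple T => tnth x i) @^-1` A (lift ord0 i))).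
    apply: fin_bigcap_measurable => // i _.
    by rewrite -[X in measurable X]setTI; exact: measurable_tnth.
  by apply/seteqP; split => x /= H i; [move=> _|]; exact: H.
Qed.

End PowerMeasure.

(* The expectation is extended-real valued: the norm is +oo when the function is
   not square-integrable. *)
Definition norm2 {d} {T : measurableType d} {R : realType}
    (P : probability T R) (g : T -> R) : \bar R :=
  sqrte ('E_P[fun x => (g x ^+ 2)%R])%E.

Section Norms.
Context {R : realType} (n : nat) (p : R).

Definition mu_ : probability (n.-tuple bool) R :=
  power_prob (bernoulli_prob p) n.

(* The second argument of [normal_prob] is the standard deviation. *)
Definition gaussian_ : probability (n.-tuple (measurableTypeR R)) R :=
  power_prob (normal_prob p (Num.sqrt (p * (1 - p)))) n.

Definition norm_mu (f : {mpoly R[n]}) : \bar R := norm2 mu_ (eval_at_cube f).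

Definition norm_gaussian (f : {mpoly R[n]}) : \bar R :=
  norm2 gaussian_ (eval_at f).

End Norms.

(* Main.v *)
(* Proof idea. Write [om_i = (x_i - p) / s] with [s^2 = p (1 - p)]. Under both product
   measures the monomials in the [om_i] are orthonormal, so both norms of a
   multilinear polynomial are the euclidean norm of its coefficients [F] in this basis.

   Let [h] be harmonic with coefficients [H]. Shift invariance of [h] makes the slice
   average of [om_A h] depend only on the [H B] with [B] included in [A]: it is
   [sum_(B <= A) H B * kappa_|B| * w_(|B|, |A \ B|)], where the moments [w] obey a
   three-term recursion. Hence the harmonic representative [G] of [F] is, up to the
   orthogonal complement of the harmonic polynomials, the polynomial [umb F] with
   coefficients [B |-> sum_(A >= B) F A * w_(|B|, |A \ B|)].

   If [4 d^2 <= s^2 n], the weights [w] are small, so [umb F] is close to [F], and [F] is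
   close to a harmonic polynomial, obtained by replacing [prod_(i in A) x_i] with the
   average of [prod_(i in A) (x_i - x_(b i))]. Otherwise it suffices that
   [|G|^2 = O(2^d) |F|^2]. On the levels [|B| >= 3 d / 4] this follows from [|w| <= 1]. On
   the levels below, [|G|^2] is compared with the slice norm of [G], which is that of [F],
   and the slice norm of [F] is compared with its norm on the cube. *)
Require Import Defs.
From mathcomp Require Import all_boot all_order all_algebra.
From mathcomp Require Import -(notations) mpoly.
From mathcomp Require Import ring lra zify.

Set Implicit Arguments.
Unset Strict Implicit.
Unset Printing Implicit Defensive.

Import Order.TTheory GRing.Theory Num.Theory.

Local Open Scope ring_scope.

(** * Coefficients of harmonic polynomials *)

(** The threshold [4 d^2 <= s^2 n] separates two kinds of work. Below it, [lam^2 * 4 d / n] and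
    [8 d^2 / n] are at most [1], which makes the weights decay and keeps their sums linear in
    [d^2 / n]. Above it, the claimed bound exceeds [20 * 2^d], so no closeness has to be shown.
    There the obstacle is the factor [kappa_e] with which level [e] enters the slice norm. For fixed
    [k] and large [n], [kappa_k] is close to [k! / k^k], which for large [k] is below [2^-k], so the
    slice norm alone cannot control the top levels at the price [2^d]. On these levels [umb F] is
    harmless instead, because a set [B] with [|B| >= 3 d / 4] has few supersets among the [d]
    variables. The fraction [3 / 4] suits both sides: [k^e] is at most
    [2^e k (k - 1) ... (k - e + 1)] for [e <= 3 k / 4], and the high levels cost [5^(d/4) (5/4)^d],
    below [2^d] since [5^5 <= 8^4]. *)

Section Harmonic.
Context {R : realFieldType} {T : finType}.
Implicit Types (F G H : {set T} -> R) (A B C U : {set T}).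

(** The summands collect the coefficient of [\prod_(j in U) x_j] in the sum of all partial
    derivatives. *)
Definition harmonic_coef H := forall U, \sum_(i | i \notin U) H (i |: U) = 0.

(** The condition at [U] involves only sets of size [#|U| + 1], so levels can be rescaled
    independently. This allows dividing by [kappa] and truncating to high levels. *)
Lemma harmonic_coef_weight H (c : nat -> R) :
  harmonic_coef H -> harmonic_coef (fun B => c #|B| * H B).
Proof.
move=> hH U; under eq_bigr => i iU do rewrite cardsU1 iU add1n.
by rewrite -mulr_sumr hH mulr0.
Qed.

(** Double counting: a set [B] in the layer [c.+1] arises by adding any of its [c.+1] elements
    outside [C]. *)
Lemma sum_superset_succ (V : zmodType) (H : {set T} -> V) C (c : nat) :
  \sum_(B : {set T} | (C \subset B) && (#|B :\: C| == c)) \sum_(i | i \notin B) H (i |: B) =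
  \sum_(B : {set T} | (C \subset B) && (#|B :\: C| == c.+1)) H B *+ c.+1.
Proof.
rewrite (exchange_big_dep predT)//=.
transitivity (\sum_(i : T) \sum_(B : {set T} | [&& C \subset B, #|B :\: C| == c.+1 & i \in B :\: C]) H B).
  apply: eq_bigr => i _.
  rewrite (reindex_onto (fun B => B :\ i) (fun B => i |: B)) /=; last first.
    by move=> B /andP[_ iB]; rewrite setU1K.
  apply: eq_big => B; last by move=> /andP[_ /eqP ->].
  rewrite !inE eqxx /= !andbT subsetD1.
  have [iB|iB] := boolP (i \in B); last first.
    rewrite andbF !andbF; apply/negP => /andP[_ /eqP E].
    by move: iB; rewrite -E setU11.
  rewrite setD1K// eqxx !andbT.
  have [CB|] := boolP (C \subset B) => //=.
  have [iC|iC] := boolP (i \in C) => /=; first by rewrite !andbF.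
  rewrite andbT.
  by rewrite setDDl setUC -setDDl (cardsD1 i (B :\: C)) !inE iB iC add1n eqSS.
rewrite (exchange_big_dep (fun B => (C \subset B) && (#|B :\: C| == c.+1)))/=; last first.
  by move=> i B _ /and3P[-> ->].
apply: eq_bigr => B /andP[CB /eqP cB].
rewrite (eq_bigl (fun i => i \in B :\: C)); last by move=> i /=; rewrite CB cB eqxx.
by rewrite sumr_const cB.
Qed.

(** Every layer above [C] sums to zero by double counting, so only [B = C] survives. The weights
    [phi] are polynomials in the shift lemma and scalars elsewhere. *)
Lemma harmonic_coef_superset_sum (V : lmodType R) H (phi : nat -> V) C :
  harmonic_coef H ->
  \sum_(B : {set T} | C \subset B) H B *: phi #|B :\: C| = H C *: phi 0%N.
Proof.
move=> hH.
have H0 c : \sum_(B : {set T} | (C \subset B) && (#|B :\: C| == c.+1)) H B = 0.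
  have := sum_superset_succ H C c.
  rewrite big1 => [|B _]; last exact: hH.
  by rewrite sumrMnl => /esym/eqP; rewrite mulrn_eq0 /= => /eqP.
rewrite (partition_big (fun B => inord #|B :\: C| : 'I_#|T|.+1) predT)//=.
rewrite big_ord_recl /= [X in _ + X]big1 ?addr0 => [|c _].
  rewrite (big_pred1 C) ?setDv ?cards0// => B /=.
  rewrite -val_eqE /= inordK ?ltnS ?max_card// cards_eq0 setD_eq0.
  by rewrite -eqEsubset eq_sym.
transitivity (\sum_(B : {set T} | (C \subset B) && (#|B :\: C| == c.+1)) H B *: phi c.+1).
  apply: eq_big => [B|B /andP[_ /eqP/(congr1 val)]] /=.
    by rewrite -val_eqE /= inordK ?ltnS ?max_card.
  by rewrite inordK ?ltnS ?max_card// => ->.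
by rewrite -scaler_suml H0 scale0r.
Qed.

Lemma prod_setD (K : comNzRingType) (f g : T -> K) :
  \prod_i (f i + g i) = \sum_(J : {set T}) (\prod_(i in J) f i) * \prod_(i in ~: J) g i.
Proof.
rewrite bigA_distr; apply: eq_bigr => J _.
rewrite (bigID (mem J)) /=; congr (_ * _).
  by apply: eq_bigr => i ->.
by apply: eq_big => [i|i /negbTE ->]//; rewrite inE.
Qed.

Lemma prod_subsetD (K : comNzRingType) A (f g : T -> K) :
  \prod_(i in A) (f i + g i) =
  \sum_(B : {set T} | B \subset A) (\prod_(i in B) f i) * \prod_(i in A :\: B) g i.
Proof.
transitivity (\prod_i ((if i \in A then f i else 0) + (if i \in A then g i else 1))).
  by rewrite big_mkcond; apply: eq_bigr => i _; case: ifP => _ //; rewrite add0r.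
rewrite prod_setD [RHS]big_mkcond; apply: eq_bigr => B _.
case: ifP => [BA|/negbT/subsetPn[i iB iA]]; last first.
  by rewrite (bigD1 i)//= (negbTE iA) !mul0r.
congr (_ * _); first by apply: eq_bigr => i /(subsetP BA) ->.
by rewrite -big_mkcondr; apply: eq_bigl => i; rewrite !inE.
Qed.

Lemma prod_if_set (K : comNzRingType) (f g : T -> K) B :
  \prod_i (if i \in B then f i else g i) =
  (\prod_(i in B) f i) * \prod_(i in ~: B) g i.
Proof.
rewrite (bigID (mem B)) /=; congr (_ * _).
  by apply: eq_bigr => i ->.
by apply: eq_big => [i|i /negbTE ->]//; rewrite inE.
Qed.

(* The homogenization of [sum_B H B prod_(i in B) x_i] at the points
   [x_i = b_i / a_i] does not change when all [x_i] are shifted by [t]. *)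
Lemma harmonic_coef_shift H (t : {poly R}) (a b : T -> {poly R}) :
  harmonic_coef H ->
  \sum_B H B *: \prod_i (if i \in B then b i + t * a i else a i) =
  \sum_B H B *: \prod_i (if i \in B then b i else a i).
Proof.
move=> hH.
(* [C] collects the indices of [B] where [b i] is chosen in the expansion. Apart from the power of
   [t], the term depends on [C] alone, so the sum over [B] collapses. *)
pose f C B := (\prod_(i in C) b i) * (\prod_(i in ~: C) a i) * t ^+ #|B :\: C|.
transitivity (\sum_(B : {set T}) \sum_(C : {set T} | C \subset B) H B *: f C B).
  apply: eq_bigr => B _; rewrite -scaler_sumr; congr (_ *: _).
  rewrite prod_if_set prod_subsetD mulr_suml; apply: eq_bigr => C CB.
  rewrite /f -!mulrA; congr (_ * _); rewrite big_split /= prodr_const -mulrA [RHS]mulrC.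
  congr (_ * _); rewrite [RHS](bigID (mem B)) /=; congr (_ * _).
    by apply: eq_bigl => i; rewrite !inE.
  apply: eq_bigl => i; rewrite !inE.
  by have [iC|] := boolP (i \in C) => //=; rewrite (subsetP CB).
rewrite (exchange_big_dep predT)//=; apply: eq_bigr => C _.
rewrite (harmonic_coef_superset_sum (fun c => _ * t ^+ c))//.
by rewrite expr0 mulr1 prod_if_set.
Qed.

End Harmonic.

(** * Moments of the slice *)

Section Slice.
Context {R : realFieldType} {T : finType}.
Implicit Types (F G H : {set T} -> R) (A B C X : {set T}).

Definition slice_avg (k : nat) (f : {set T} -> R) : R :=
  (\sum_(X : {set T} | #|X| == k) f X) / ('C(#|T|, k))%:R.

Lemma sum_slice_prod k (u v : T -> R) :
  \sum_(X : {set T} | #|X| == k) \prod_i (if i \in X then u i else v i) =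
  (\prod_i (u i *: 'X + (v i)%:P))`_k.
Proof.
rewrite bigA_distr coef_sum big_mkcond /=; apply: eq_bigr => X _.
rewrite !prod_if_set scaler_prod prodr_const -scalerAl coefZ.
rewrite -rmorph_prod coefMC coefXn [k == _]eq_sym.
by case: eqP => _; rewrite ?mul1r ?mul0r ?mulr0.
Qed.

Variables (k : nat) (p s : R).

Definition std_coord X (i : T) : R := ((i \in X)%:R - p) / s.
Local Notation om := std_coord.

Definition chaos_sum F X : R := \sum_A F A * \prod_(i in A) om X i.
Local Notation chaos := chaos_sum.

Local Notation n := #|T|.
Local Notation lam := ((1 - 2 * p) / s).

(** The slice average of a product of [j] distinct [om_i]; extracting a coefficient avoids the
    choice of a [j]-element set. *)
Definition slice_moment j : R :=
  ((((1 - p) / s) *: 'X + (- p / s)%:P) ^+ j * ('X + 1) ^+ (n - j))`_k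
  / ('C(n, k))%:R.
Local Notation mom := slice_moment.

Lemma slice_avg_prod_std_coord A : slice_avg k (fun X => \prod_(i in A) om X i) = mom #|A|.
Proof.
rewrite /slice_avg /mom; congr (_ / _).
under eq_bigr => X _.
  rewrite big_mkcond /=.
  rewrite (_ : \prod_i _ = \prod_i (if i \in X then (if i \in A then (1 - p) / s else 1)
     else (if i \in A then - p / s else 1))); last first.
    by apply: eq_bigr => i _; rewrite /om; do 2 case: ifP => _ //; rewrite sub0r.
  over.
rewrite sum_slice_prod; congr ((polyseq _)`_k).
transitivity (\prod_i (if i \in A then ((1 - p) / s) *: 'X + (- p / s)%:P else 'X + 1)).
  by apply: eq_bigr => i _; case: ifP => // _; rewrite scale1r.
rewrite prod_if_set !prodr_const; congr (_ * _ ^+ _).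
by rewrite cardsCs setCK.
Qed.

Lemma slice_avg_sum (I : Type) (r : seq I) (P : pred I) (c : I -> R) (f : I -> {set T} -> R) :
  slice_avg k (fun X => \sum_(i <- r | P i) c i * f i X) =
  \sum_(i <- r | P i) c i * slice_avg k (f i).
Proof.
rewrite /slice_avg exchange_big /= mulr_suml.
by apply: eq_bigr => i _; rewrite -mulr_sumr mulrA.
Qed.

Lemma eq_slice_avg f g : (forall X, #|X| = k -> f X = g X) ->
  slice_avg k f = slice_avg k g.
Proof.
by move=> fg; rewrite /slice_avg; congr (_ / _); apply: eq_bigr => X /eqP/fg.
Qed.

(* ['X^j] stands for a product of [j] distinct coordinates. A squared coordinate is
   then [1 + lam *: 'X], by [std_coord_sq], and [psi], the umbra of
   [om_i * (om_i - om_j)], is what is left of a factor [i] of a harmonic polynomial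
   after the shift by [- 'X]. *)
Definition slice_umbra (q : {poly R}) : R := \sum_(j < n.+1) q`_j * mom j.

Lemma slice_umbraD q r : slice_umbra (q + r) = slice_umbra q + slice_umbra r.
Proof.
by rewrite /slice_umbra -big_split; apply: eq_bigr => j _; rewrite coefD mulrDl.
Qed.

Lemma slice_umbraZ c q : slice_umbra (c *: q) = c * slice_umbra q.
Proof.
by rewrite /slice_umbra mulr_sumr; apply: eq_bigr => j _; rewrite coefZ -mulrA.
Qed.

Lemma slice_umbraB q r : slice_umbra (q - r) = slice_umbra q - slice_umbra r.
Proof. by rewrite -scaleN1r slice_umbraD slice_umbraZ mulN1r. Qed.

Lemma slice_umbra_sum (I : Type) (r : seq I) (P : pred I) (c : I -> R) f :
  slice_umbra (\sum_(i <- r | P i) c i *: f i) =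
  \sum_(i <- r | P i) c i * slice_umbra (f i).
Proof.
rewrite /slice_umbra; under eq_bigr => j _ do rewrite coef_sum mulr_suml.
rewrite exchange_big /=; apply: eq_bigr => i _; rewrite mulr_sumr.
by apply: eq_bigr => j _; rewrite coefZ -mulrA.
Qed.

Lemma slice_umbraXn j : (j <= n)%N -> slice_umbra 'X^j = mom j.
Proof.
rewrite -ltnS => jn; rewrite /slice_umbra (bigD1 (Ordinal jn))//=.
rewrite coefXn eqxx mul1r big1 ?addr0// => i.
by rewrite -val_eqE /= coefXn => /negbTE ->; rewrite mul0r.
Qed.

(** Each coordinate occurs in one factor only, so the expansion contains only products of distinct
    coordinates, which ['X^j] represents. *)
Lemma slice_avg_prod_affine (a b : T -> R) :
  slice_avg k (fun X => \prod_i (a i + b i * om X i)) =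
  slice_umbra (\prod_i ((a i)%:P + b i *: 'X)).
Proof.
under eq_slice_avg => X _.
  under eq_bigr => i _ do rewrite addrC.
  rewrite prod_setD.
  under eq_bigr => J _ do rewrite big_split /= mulrAC.
  over.
rewrite slice_avg_sum.
under [X in _ = _ X]eq_bigr => i _ do rewrite addrC.
rewrite prod_setD.
under [X in _ = _ X]eq_bigr => J _.
  rewrite scaler_prod prodr_const -rmorph_prod mulrC mul_polyC scalerA mulrC.
  over.
rewrite slice_umbra_sum; apply: eq_bigr => J _.
by rewrite slice_avg_prod_std_coord slice_umbraXn ?max_card.
Qed.

Hypothesis s0 : s != 0.
Hypothesis s2 : s ^+ 2 = p * (1 - p).
Hypothesis pn : p * n%:R = k%:R.

Lemma std_coord_sq X i : om X i ^+ 2 = 1 + lam * om X i.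
Proof.
rewrite /om; case: (i \in X) => /=; field: s2; exact: s0.
Qed.

Lemma sum_std_coord X : #|X| = k -> \sum_i om X i = 0.
Proof.
move=> Xk; rewrite /om -mulr_suml sumrB sumr_const -natr_sum.
rewrite (_ : (\sum_i (i \in X))%N = k); last by rewrite -Xk -sum1_card [RHS]big_mkcond.
by rewrite -pn mulr_natr subrr mul0r.
Qed.

Lemma ex_card (j : nat) : (j <= n)%N -> exists A : {set T}, #|A| = j.
Proof.
move=> jn; exists [set x in take j (enum T)].
by rewrite cardsE (card_uniqP _) ?take_uniq ?enum_uniq// size_takel// -cardE.
Qed.

Lemma prod_std_coordU1 A X i : i \notin A ->
  \prod_(j in i |: A) om X j = om X i * \prod_(j in A) om X j.
Proof. by move=> iA; rewrite big_setU1. Qed.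

Lemma slice_avgD f g :
  slice_avg k (fun X => f X + g X) = slice_avg k f + slice_avg k g.
Proof. by rewrite /slice_avg big_split mulrDl. Qed.

Lemma slice_avgZ c f : slice_avg k (fun X => c * f X) = c * slice_avg k f.
Proof. by rewrite /slice_avg -mulr_sumr mulrA. Qed.

(** Multiply [\prod_(i in A) om X i] by the sum of all coordinates, which is zero on the slice. An
    index outside [A] gives [mom j.+1]; one inside gives a square, reduced by [std_coord_sq]. *)
Lemma slice_moment_rec j : (j <= n)%N ->
  (n%:R - j%:R) * mom j.+1 + j%:R * (lam * mom j + mom j.-1) = 0.
Proof.
move=> /ex_card[A <-].
rewrite -!slice_avg_prod_std_coord.
have : slice_avg k (fun X => \sum_i 1 * (om X i * \prod_(j in A) om X j)) = 0.
  transitivity (slice_avg k (fun=> 0 : R)); last by rewrite /slice_avg big1 ?mul0r.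
  apply: eq_slice_avg => X /sum_std_coord Xk /=.
  under eq_bigr => i _ do rewrite mul1r.
  by rewrite -mulr_suml Xk mul0r.
rewrite (slice_avg_sum _ _ (fun=> 1) (fun i X => om X i * \prod_(j in A) om X j)).
under eq_bigr do rewrite mul1r.
rewrite (bigID (mem A)) /= addrC => <-; congr (_ + _).
  rewrite (eq_bigr (fun=> mom #|A|.+1)) => [|i iA]; last first.
    have := slice_avg_prod_std_coord (i |: A); rewrite cardsU1 iA add1n => <-.
    by apply: eq_slice_avg => X _; rewrite prod_std_coordU1.
  rewrite sumr_const -[RHS]mulr_natl -natrB ?max_card//.
  by rewrite -(cardC A) addKn.
rewrite (eq_bigr (fun=> lam * mom #|A| + mom #|A|.-1)) => [|i iA]; last first.
  rewrite -(slice_avg_prod_std_coord A).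
  have := slice_avg_prod_std_coord (A :\ i); rewrite cardsDS ?sub1set// cards1 subn1 => <-.
  rewrite -slice_avgZ -slice_avgD; apply: eq_slice_avg => X _.
  rewrite [in LHS](big_setD1 i)//= mulrA -expr2 std_coord_sq mulrDl mul1r addrC.
  by rewrite [in RHS](big_setD1 i)//= -(mulrA lam).
by rewrite sumr_const mulr_natl -slice_avg_prod_std_coord.
Qed.

Definition psi_poly : {poly R} := 1 + lam *: 'X - 'X^2.
Local Notation psi := psi_poly.

(* The constraint [sum_i om_i = 0], in the form of an integration by parts. *)
Lemma slice_umbra_ibp (q : {poly R}) : (size q <= n.+1)%N ->
  slice_umbra (n%:R *: ('X * q) + psi * q^`()) = 0.
Proof.
move=> sq; rewrite (_ : _ + _ = \sum_(j < n.+1) q`_j *: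
    ((n%:R - j%:R) *: 'X^(j.+1) + j%:R *: (lam *: 'X^j + 'X^(j.-1)))).
  rewrite slice_umbra_sum big1// => j _.
  rewrite slice_umbraD !slice_umbraZ slice_umbraD slice_umbraZ.
  have jn : (j <= n)%N by rewrite -ltnS.
  rewrite (slice_umbraXn jn) (slice_umbraXn (leq_trans (leq_pred _) jn)).
  (* At [j = n] the umbra truncates ['X^(n.+1)], but its coefficient [n - j] is zero. *)
  have [jn'|jn'] := ltnP j n; last first.
    have E : j = n :> nat by apply/eqP; rewrite eqn_leq jn.
    by have := slice_moment_rec jn; rewrite E subrr !mul0r => ->; rewrite mulr0.
  by rewrite slice_umbraXn// slice_moment_rec// mulr0.
rewrite -[q in LHS](coefK q) (poly_def (size q)).
rewrite (big_ord_widen _ (fun j => q`_j *: 'X^j) sq) big_mkcond.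
rewrite (raddf_sum (@deriv R)) !mulr_sumr scaler_sumr -big_split /=; apply: eq_bigr => j _.
case: ifP => [_|/negbT]; last first.
  by rewrite -leqNgt => /leq_sizeP -> //; rewrite scale0r deriv0 !mulr0 scaler0 addr0.
rewrite derivZ derivXn -!scalerAr scalerA (mulrC n%:R) -(scalerA q`_j) -scalerDr; congr (_ *: _).
rewrite /psi; case: (nat_of_ord j) => [|i] /=.
  by rewrite mulr0n mulr0 scale0r subr0 !addr0 expr1 expr0 mulr1.
rewrite -!mul_polyC !polyCB !polyC_natr -[_ *+ i.+1]mulr_natl !exprS; ring.
Qed.

Definition psi_moment e j : R := slice_umbra (psi ^+ e * 'X^j).
Local Notation W := psi_moment.

Lemma size_psi_poly_exp e j : (size (psi ^+ e * 'X^j)%R <= (2 * e + j).+1)%N.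
Proof.
have spsi : (size psi <= 3)%N.
  rewrite /psi (leq_trans (size_polyD _ _))// size_polyN size_polyXn geq_max leqnn andbT.
  rewrite (leq_trans (size_polyD _ _))// size_poly1 geq_max /=.
  by rewrite (leq_trans (size_scale_leq _ _))// size_polyX.
have [->|X0] := eqVneq (psi ^+ e) 0; first by rewrite mul0r size_poly0.
rewrite size_mulXn// addnC -addSn leq_add2r.
by rewrite (leq_trans (size_poly_exp_leq _ _))// ltnS leq_mul2r; lia.
Qed.

Lemma deriv_psi_poly : psi^`() = lam%:P - 2%:R *: 'X.
Proof.
by rewrite /psi !derivE add0r expr1 -alg_polyC scaler_nat.
Qed.

(** Integration by parts with [q = psi ^+ e * 'X^j]. Multiplying the derivative of [q] by [psi]
    restores the factor [psi ^+ e], so the recursion closes at fixed [e]; [2 e] and [j] come from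
    the leading terms of the derivative of [psi] and of [psi]. *)
Lemma psi_moment_rec e j : (2 * e + j <= n)%N ->
  (n%:R - (2 * e + j)%:R) * W e j.+1 =
  - ((e + j)%:R * lam * W e j + j%:R * W e j.-1).
Proof.
move=> ejn; apply/eqP; rewrite -subr_eq0 opprK; apply/eqP.
have /slice_umbra_ibp <- := leq_trans (size_psi_poly_exp e j) (ejn : (_ < n.+1)%N).
rewrite /W -!slice_umbraZ -!slice_umbraD; congr slice_umbra.
rewrite derivM deriv_exp derivXn deriv_psi_poly.
have E : psi * (((lam%:P - 2%:R *: 'X) * psi ^+ e.-1) *+ e) =
         e%:R *: ((lam%:P - 2%:R *: 'X) * psi ^+ e).
  by case: e {ejn} => [|e] /=; rewrite ?mulr0n ?mulr0 ?scale0r// exprS -scaler_nat -!mul_polyC; ring.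
rewrite mulrDr (mulrA psi _ 'X^j) E; clear E.
have E : psi * (psi ^+ e * ('X^(j.-1) *+ j)) = psi ^+ e *
    (j%:R *: (lam *: 'X^j + 'X^(j.-1) - 'X^(j.+1))).
  rewrite mulrCA; congr (_ * _); rewrite /psi; case: j {ejn} => [|j] /=.
    by rewrite mulr0n mulr0 scale0r.
  by rewrite -scaler_nat -!mul_polyC !exprS; ring.
rewrite E (natrD _ (2 * e)) (natrD _ e) (natrM _ 2) exprS -!mul_polyC !polyCB !polyCM !polyCD !polyC_natr polyCM; ring.
Qed.

Lemma psi_moment_succ e : W e.+1 0 = W e 0 + lam * W e 1 - W e 2.
Proof.
rewrite /W -slice_umbraZ -slice_umbraD -slice_umbraB; congr slice_umbra.
by rewrite exprSr {2}/psi -!mul_polyC; ring.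
Qed.

(** Two steps of [psi_moment_rec] reduce [W e 1] and [W e 2] in [psi_moment_succ] to [W e 0]. The
    right-hand side factors thanks to [s ^+ 2 = p * (1 - p)]. *)
Lemma level_factor_rec e : (2 * e + 2 <= n)%N ->
  s ^+ 2 * (n%:R - 2 * e%:R) * (n%:R - 2 * e%:R - 1) * W e.+1 0 =
  (k%:R - e%:R) * (n%:R - k%:R - e%:R) * W e 0.
Proof.
move=> en; have /psi_moment_rec : (2 * e + 0 <= n)%N by lia.
rewrite !addn0 mul0r addr0 (natrM _ 2) => E1.
have /psi_moment_rec : (2 * e + 1 <= n)%N by lia.
rewrite mul1r /= (natrD _ (2 * e)) (natrD _ e) (natrM _ 2) => E2.
rewrite psi_moment_succ.
transitivity (s ^+ 2 * (n%:R - 2 * e%:R) * (n%:R - 2 * e%:R - 1) * W e 0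
   + s ^+ 2 * (n%:R - 2 * e%:R - 1) * lam * ((n%:R - 2 * e%:R) * W e 1)
   - s ^+ 2 * (n%:R - 2 * e%:R) * ((n%:R - (2 * e%:R + 1)) * W e 2)); first by ring.
rewrite E1 E2.
transitivity (s ^+ 2 * (n%:R - 2 * e%:R) * (n%:R - 2 * e%:R) * W e 0
   - s ^+ 2 * (n%:R - 2 * e%:R - 1) * lam * (e%:R * lam * W e 0)
   + s ^+ 2 * (e%:R + 1) * lam * ((n%:R - 2 * e%:R) * W e 1)); first by ring.
rewrite E1.
rewrite -pn; field: s2; exact: s0.
Qed.

Lemma slice_avg_harmonic A H : harmonic_coef H ->
  slice_avg k (fun X => (\prod_(i in A) om X i) * chaos H X) =
  \sum_(B : {set T} | B \subset A) H B * W #|B| #|A :\: B|.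
Proof.
move=> hH.
(* Umbral factor at [i] of [om_A * om_B], for [i] outside ([a]) and inside ([b]) the set [B]. *)
pose a i : {poly R} := if i \in A then 'X else 1.
pose b i : {poly R} := if i \in A then 1 + lam *: 'X else 'X.
transitivity (slice_umbra (\sum_(B : {set T}) H B *: \prod_i (if i \in B then b i else a i))).
  rewrite slice_umbra_sum.
  pose u B i : R := if i \in A then (if i \in B then 1 else 0) else (if i \in B then 0 else 1).
  pose v B i : R := if i \in A then (if i \in B then lam else 1) else (if i \in B then 1 else 0).
  transitivity (\sum_(B : {set T}) H B * slice_avg k (fun X => \prod_i (u B i + v B i * om X i))).
    rewrite -slice_avg_sum; apply: eq_slice_avg => X _.
    rewrite /chaos mulr_sumr; apply: eq_bigr => B _.
    rewrite mulrCA; congr (_ * _).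
    rewrite [X in X * _ = _]big_mkcond [X in _ * X = _]big_mkcond -big_split /=.
    apply: eq_bigr => i _; rewrite /u /v.
    by do 2 case: ifP => _; rewrite ?mul1r ?mulr1 ?add0r ?mul0r ?addr0// -expr2 std_coord_sq.
  apply: eq_bigr => B _; rewrite slice_avg_prod_affine; congr (_ * slice_umbra _).
  apply: eq_bigr => i _; rewrite /u /v /a /b.
  by do 2 case: ifP => _; rewrite ?polyC1 ?polyC0 ?scale0r ?scale1r ?add0r ?addr0.
(* The shift turns [b i] into [b i - 'X * a i]: this is [psi] for [i] in [A], and [0] outside, which
   kills every [B] not included in [A]. *)
rewrite -(harmonic_coef_shift (- 'X)) //.
rewrite [in RHS]big_mkcond slice_umbra_sum; apply: eq_bigr => B _.
case: ifP => [BA|/negbT/subsetPn[i iB iA]]; last first.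
  rewrite (bigD1 i)//= iB /a /b (negbTE iA) mulr1 subrr mul0r.
  by rewrite -(scale0r 0) slice_umbraZ mul0r mulr0.
congr (_ * slice_umbra _).
rewrite prod_if_set -prodr_const; congr (_ * _).
  apply: eq_bigr => i /(subsetP BA) iA; rewrite /a /b iA.
  by rewrite /psi expr2 mulNr.
rewrite -prodr_const (bigID (mem A)) /= [X in _ * X]big1 ?mulr1 => [|i /andP[_ /negbTE]]; last first.
  by rewrite /a => ->.
apply: eq_big => [i|i /andP[_ iA]]; first by rewrite !inE.
by rewrite /a iA.
Qed.

End Slice.

(** * Transfer between the slice and the product measures *)

Section Transfer.
Context {R : realFieldType} {T : finType}.
Implicit Types (F G H : {set T} -> R) (A B C X S : {set T}).
Variables (k : nat) (p s : R).
Local Notation n := #|T|.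
Local Notation lam := ((1 - 2 * p) / s).
Local Notation chaos := (chaos_sum p s).
Local Notation W := (@psi_moment R T k p s).
Hypothesis s0 : 0 < s.
Hypothesis s2 : s ^+ 2 = p * (1 - p).
Hypothesis pn : p * n%:R = k%:R.
Hypothesis kn : (2 * k <= n)%N.

Let sn0 : s != 0. Proof. by rewrite gt_eqF. Qed.

Definition level_factor e := W e 0.
Local Notation kappa := level_factor.

Lemma level_factor0 : kappa 0 = 1.
Proof.
rewrite /level_factor /psi_moment expr0 mul1r slice_umbraXn//.
have <- : #|(set0 : {set T})| = 0%N by rewrite cards0.
rewrite -slice_avg_prod_std_coord /slice_avg.
rewrite (eq_bigr (fun=> 1)) => [|X _]; last by rewrite big_set0.
rewrite sumr_const -[X in _ *+ X]cardsE.
rewrite (_ : [set X : {set T} | _] = [set X : {set T} | X \subset [set: T] & #|X| == k]).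
  by rewrite cards_draws cardsT divff// pnatr_eq0 -lt0n bin_gt0 (leq_trans _ kn)// leq_pmull.
by apply/setP => X; rewrite !inE subsetT.
Qed.

Lemma level_factor_succ e : (e < k)%N ->
  kappa e.+1 = (k%:R - e%:R) * (n%:R - k%:R - e%:R) /
     (s ^+ 2 * (n%:R - 2 * e%:R) * (n%:R - 2 * e%:R - 1)) * kappa e.
Proof.
move=> ek; have /(level_factor_rec sn0 s2 pn) E : (2 * e + 2 <= n)%N by lia.
have n1 : (n%:R : R) - 2 * e%:R != 0.
  by rewrite -natrM -natrB ?pnatr_eq0; lia.
have n2 : (n%:R : R) - 2 * e%:R - 1 != 0.
  rewrite (_ : _ - 1 = (n - 2 * e - 1)%:R) ?pnatr_eq0; first by lia.
  by rewrite !natrB ?natrM//; lia.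
rewrite mulrAC -[_ * kappa e]E.
by rewrite mulrAC divff ?mul1r// !mulf_neq0// expf_neq0.
Qed.

Lemma level_factor_gt0 e : (e <= k)%N -> 0 < kappa e.
Proof.
elim: e => [|e IH] ek; first by rewrite level_factor0.
rewrite level_factor_succ// mulr_gt0 ?IH ?(ltnW ek)//.
rewrite divr_gt0 ?mulr_gt0 ?exprn_gt0//.
- by rewrite subr_gt0 ltr_nat.
- by rewrite subr_gt0 ltrBrDr -natrD ltr_nat; lia.
- by rewrite subr_gt0 -natrM ltr_nat; lia.
- rewrite (_ : _ - 1 = (n - 2 * e - 1)%:R) ?ltr0n; first by lia.
  by rewrite !natrB ?natrM//; lia.
Qed.

Definition psi_ratio e j := W e j / kappa e.
Local Notation w := psi_ratio.

Lemma psi_ratio0 e : (e <= k)%N -> w e 0 = 1.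
Proof. by move=> /level_factor_gt0 h; rewrite /psi_ratio divff// gt_eqF. Qed.

Lemma psi_ratio_rec e j : (e + j < k)%N ->
  w e j.+1 = - ((e + j)%:R * lam * w e j + j%:R * w e j.-1) / (n%:R - (2 * e + j)%:R).
Proof.
move=> ejk; have /(psi_moment_rec sn0 s2 pn) E : (2 * e + j <= n)%N by lia.
have n1 : (n%:R : R) - (2 * e + j)%:R != 0 by rewrite -natrB ?pnatr_eq0; lia.
rewrite mulrC in E; rewrite /psi_ratio (canRL (mulfK n1) E); ring.
Qed.

(* The harmonic representative on the slice agrees with [umb F] up to the orthogonal
   complement of the harmonic polynomials. *)
Definition umbral_coef F B := \sum_(A : {set T} | B \subset A) F A * w #|B| #|A :\: B|.
Local Notation umb := umbral_coef.

Definition coef_deg_le H := forall B, (k < #|B|)%N -> H B = 0.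

Lemma umbral_coef_harmonic G B : harmonic_coef G -> (#|B| <= k)%N -> umb G B = G B.
Proof.
move=> hG Bk; rewrite /umbral_coef.
have := @harmonic_coef_superset_sum R T R^o G (w #|B|) B hG.
by rewrite /GRing.scale /= psi_ratio0// mulr1.
Qed.

Lemma slice_avg_mul F H : harmonic_coef H -> coef_deg_le H ->
  slice_avg k (fun X => chaos F X * chaos H X) =
  \sum_(B : {set T}) kappa #|B| * H B * umb F B.
Proof.
move=> hH lH.
transitivity (slice_avg k (fun X => \sum_(A : {set T}) F A * ((\prod_(i in A) std_coord p s X i) * chaos H X))).
  apply: eq_slice_avg => X _; rewrite [X in X * _]/chaos_sum mulr_suml.
  by apply: eq_bigr => A _; rewrite mulrA.
rewrite slice_avg_sum.
under eq_bigr => A _ do rewrite (slice_avg_harmonic k sn0 s2)// mulr_sumr.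
rewrite (exchange_big_dep predT)//=; apply: eq_bigr => B _.
rewrite mulr_sumr; apply: eq_bigr => A BA.
have [Bk|Bk] := leqP #|B| k; last by rewrite lH// !(mulr0, mul0r).
rewrite /psi_ratio; field.
by rewrite gt_eqF// level_factor_gt0.
Qed.

Lemma slice_avg_harmonic_sq G : harmonic_coef G -> coef_deg_le G ->
  slice_avg k (fun X => chaos G X ^+ 2) = \sum_(B : {set T}) kappa #|B| * G B ^+ 2.
Proof.
move=> hG lG; under eq_slice_avg => X _ do rewrite expr2.
rewrite slice_avg_mul//; apply: eq_bigr => B _.
have [Bk|Bk] := leqP #|B| k; last by rewrite lG// expr0n !(mulr0, mul0r).
by rewrite umbral_coef_harmonic// expr2 mulrA.
Qed.

Variables (F G : {set T} -> R).
Hypothesis hG : harmonic_coef G.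
Hypothesis lG : coef_deg_le G.
Hypothesis FG : forall X, #|X| = k -> chaos F X = chaos G X.

(** Testing against [H / kappa], still harmonic, turns the [kappa]-weighted slice product into the
    Euclidean one. Above level [k], where [kappa] need not be invertible, [H] vanishes. *)
Lemma umbral_coef_orthogonal H : harmonic_coef H -> coef_deg_le H ->
  \sum_(B : {set T}) H B * (umb F B - G B) = 0.
Proof.
move=> hH lH.
pose H' B := (kappa #|B|)^-1 * H B.
have hH' : harmonic_coef H' := harmonic_coef_weight (fun j => (kappa j)^-1) hH.
have lH' : coef_deg_le H' by move=> B Bk; rewrite /H' lH// mulr0.
have := slice_avg_mul F hH' lH'.
rewrite (@eq_slice_avg _ _ _ _ (fun X => chaos G X * chaos H' X)) => [|X /FG -> //].
rewrite slice_avg_mul// => /eqP; rewrite eq_sym -subr_eq0 -sumrB => /eqP E.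
rewrite -[RHS]E; apply: eq_bigr => B _; rewrite /H'.
have [Bk|Bk] := leqP #|B| k; last by rewrite lH// !(mulr0, mul0r) subrr.
rewrite (umbral_coef_harmonic hG)//; field.
by rewrite gt_eqF// level_factor_gt0.
Qed.

End Transfer.

(** * Bounds on the umbral weights *)

Lemma cauchy_schwarz_sum (R : realFieldType) (I : finType) (P : pred I) (a b : I -> R) :
  (\sum_(i | P i) a i * b i) ^+ 2 <=
  (\sum_(i | P i) a i ^+ 2) * (\sum_(i | P i) b i ^+ 2).
Proof.
rewrite -subr_ge0 expr2 !big_distrlr /= -sumrB.
under eq_bigr => i _ do rewrite -sumrB.
rewrite -(pmulr_rge0 _ (ltr0n R 2)) mulr2n mulrDl !mul1r [X in _ + X]exchange_big /=.
rewrite -big_split /=; apply: sumr_ge0 => i Pi.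
rewrite -big_split /=; apply: sumr_ge0 => j Pj.
have -> : a i ^+ 2 * b j ^+ 2 - a i * b i * (a j * b j) +
          (a j ^+ 2 * b i ^+ 2 - a j * b j * (a i * b i)) =
          (a i * b j - a j * b i) ^+ 2 by ring.
exact: sqr_ge0.
Qed.

Section Sums.
Context {R : realFieldType} {T : finType}.
Implicit Types (A B S : {set T}).

Lemma sum_subset_exp (x : R) A :
  \sum_(B : {set T} | B \subset A) x ^+ #|A :\: B| = (1 + x) ^+ #|A|.
Proof.
rewrite -prodr_const prod_subsetD; apply: eq_bigr => B _.
by rewrite big1// mul1r prodr_const.
Qed.

Lemma sum_superset_exp (x : R) B S : B \subset S ->
  \sum_(A : {set T} | (B \subset A) && (A \subset S)) x ^+ #|A :\: B| =
  (1 + x) ^+ #|S :\: B|.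
Proof.
move=> BS; rewrite -sum_subset_exp.
rewrite (reindex_onto (fun C => S :\: C) (fun A => S :\: A)) /=; last first.
  by move=> A /andP[_ AS]; rewrite setDDr setDv set0U (setIidPr AS).
apply: eq_big => [C|C _]; last by rewrite setDDl setUC -setDDl.
rewrite subsetDl andbT setDDr setDv set0U !subsetD BS /=.
by rewrite disjoint_sym andbC; congr (_ && _); apply/eqP/idP => /setIidPr.
Qed.
End Sums.

Section Bounds.
Context {R : realFieldType} {T : finType}.
Implicit Types (F G H : {set T} -> R) (A B C X S : {set T}).
Variables (k : nat) (p s : R).
Local Notation n := #|T|.
Local Notation lam := ((1 - 2 * p) / s).
Local Notation w := (@psi_ratio R T k p s).
Hypothesis p0 : 0 < p.
Hypothesis p2 : p * 2 <= 1.
Hypothesis s0 : 0 < s.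
Hypothesis s2 : s ^+ 2 = p * (1 - p).
Hypothesis pn : p * n%:R = k%:R.
Hypothesis kn : (2 * k <= n)%N.

Let lam0 : 0 <= lam. Proof. by rewrite divr_ge0 ?(ltW s0)//; move: p2; lra. Qed.

(** Since [p <= 1 - p], also [p <= s], and [k * lam = n (1 - 2 p) * (p / s)]. *)
Let lamk : k%:R * lam <= n%:R - 2 * k%:R.
Proof.
rewrite -pn.
have ps : p / s <= 1.
  rewrite ler_pdivrMr// mul1r -(ler_pXn2r (_ : 0 < 2)%N) ?nnegrE ?(ltW p0) ?(ltW s0)// s2.
  by rewrite expr2 ler_pM2l//; move: p2; lra.
rewrite [leLHS](_ : _ = (n%:R * (1 - 2 * p)) * (p / s)); last by ring.
rewrite [leRHS](_ : _ = (n%:R * (1 - 2 * p)) * 1); last by ring.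
by apply: ler_wpM2l => //; rewrite mulr_ge0//; move: p2; lra.
Qed.

(** By induction the numerator of the recursion is at most [k * lam + j <= n - 2 k + j], which the
    denominator [n - 2 e - j] dominates as long as [e + j <= k]. *)
Lemma psi_ratio_le1 e j : (e + j <= k)%N -> `|w e j| <= 1.
Proof.
elim/ltn_ind: j => -[|j] IH ejk; first by rewrite psi_ratio0// ?normr1//; lia.
rewrite psi_ratio_rec//; last by lia.
have D0 : 0 < (n%:R : R) - (2 * e + j)%:R by rewrite subr_gt0 ltr_nat; lia.
rewrite normrM normfV (gtr0_norm D0) ler_pdivrMr// mul1r normrN.
apply: (le_trans (ler_normD _ _)); rewrite (normrM _ (w e j)) (normrM _ (w e j.-1)).
rewrite (ger0_norm (mulr_ge0 (ler0n _ _) lam0)) normr_nat.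
have h1 : (e + j)%:R * lam * `|w e j| <= k%:R * lam.
  have wj : `|w e j| <= 1 by apply: IH; lia.
  rewrite -[leRHS]mulr1; apply: ler_pM => //; first by rewrite mulr_ge0.
  by rewrite ler_wpM2r// ler_nat; lia.
have h2 : j%:R * `|w e j.-1| <= j%:R.
  have wj : `|w e j.-1| <= 1 by apply: IH; lia.
  by rewrite -[leRHS]mulr1 ler_wpM2l.
apply: (le_trans (lerD h1 h2)); apply: (le_trans (lerD lamk (lexx _))).
have : ((2 * k)%:R : R) >= (2 * e + j + j)%:R by rewrite ler_nat; lia.
by rewrite natrM natrD; lra.
Qed.

Variable d : nat.
Hypothesis dk : (d <= k)%N.
Local Notation beta := ((4 * d)%:R / n%:R : R).

Section SmallDegree.
Hypothesis d2n : (4 * d ^ 2)%:R <= s ^+ 2 * n%:R.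

Let s1 : s ^+ 2 <= 4^-1.
Proof. by rewrite s2; have := sqr_ge0 (p - 2^-1); rewrite expr2; lra. Qed.

Hypothesis n0 : (0 < n)%N.

Let nR0 : 0 < (n%:R : R). Proof. by rewrite ltr0n. Qed.

Let beta0 : 0 <= beta. Proof. by rewrite divr_ge0. Qed.

Let d4n : (4 * d ^ 2)%:R <= (n%:R : R).
Proof.
by apply: (le_trans d2n); rewrite -[leRHS]mul1r ler_wpM2r//; have := s1; lra.
Qed.

Let dd4 : (4 * d <= n)%N.
Proof. by have := d4n; rewrite ler_nat; apply: leq_trans; rewrite leq_mul2l -mulnn; case: d => // m; rewrite leq_pmull. Qed.

Let lam2 : lam ^+ 2 <= s ^- 2.
Proof.
rewrite exprMn -[leRHS]mul1r exprVn ler_wpM2r ?invr_ge0 ?sqr_ge0//.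
by move: p0 p2; rewrite expr2; nra.
Qed.

Let lam2d : lam ^+ 2 * (4 * d ^ 2)%:R <= n%:R.
Proof.
have h := ler_pM (sqr_ge0 _) (ler0n _ _) lam2 d2n.
by apply: (le_trans h); rewrite mulrA mulVf ?mul1r// expf_neq0// gt_eqF.
Qed.

(** The denominator is at least [n / 2], and [lam ^+ 2 * beta <= 1] makes both terms of the
    numerator at most [d ^+ 2 * beta ^+ j.-1] after squaring. Altogether [16 d^2 / n^2 = beta ^+ 2]
    is gained, whence the [4] in [beta]. *)
Lemma psi_ratio_sq_le e j : (e + j <= d)%N -> w e j ^+ 2 <= beta ^+ j.
Proof.
elim/ltn_ind: j => -[|j] IH ejd; first by rewrite expr0 (psi_ratio0 s0 s2 pn kn); [rewrite expr1n | apply: leq_trans dk; rewrite addn0 in ejd].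
have ejk : (e + j < k)%N by apply: leq_trans dk; rewrite -addnS.
rewrite psi_ratio_rec//.
have D0 : 0 < (n%:R : R) - (2 * e + j)%:R by rewrite subr_gt0 ltr_nat; move: ejk kn; clear; lia.
have D1 : n%:R / 2 <= (n%:R : R) - (2 * e + j)%:R.
  rewrite lerBrDr -lerBrDl (_ : n%:R - _ = n%:R / 2); last by field.
  rewrite ler_pdivlMr// -natrM ler_nat; move: ejd dd4; clear; lia.
rewrite exprMn sqrrN exprVn ler_pdivrMr ?exprn_gt0//.
have D2 : n%:R ^+ 2 / 4 <= ((n%:R : R) - (2 * e + j)%:R) ^+ 2.
  rewrite (_ : _ / 4 = (n%:R / 2) ^+ 2); last by field.
  by rewrite ler_pXn2r// nnegrE ltW// divr_gt0.
apply: le_trans (ler_wpM2l (exprn_ge0 _ beta0) D2).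
have bn : beta * n%:R = (4 * d)%:R by rewrite divfK// gt_eqF.
have d1 : (1 : R) <= d%:R by rewrite ler1n; move: ejd; clear; lia.
have aj : (e + j)%:R <= (d%:R : R) by rewrite ler_nat; move: ejd; clear; lia.
have lb : lam ^+ 2 * (4 * d%:R) <= n%:R.
  apply: le_trans lam2d; rewrite ler_wpM2l ?sqr_ge0// natrM ler_wpM2l//.
  by rewrite natrX expr2 ler_peMr//; move: d1; lra.
have wj : w e j ^+ 2 <= beta ^+ j by apply: IH => //; apply: leq_trans ejd; rewrite leq_add2l.
have a2 : (e + j)%:R ^+ 2 <= (d%:R : R) ^+ 2.
  by rewrite ler_pXn2r ?nnegrE.
have x2 : ((e + j)%:R * lam * w e j) ^+ 2 <= d%:R ^+ 2 * lam ^+ 2 * beta ^+ j.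
  rewrite (exprMn _ (_ * lam)) (exprMn _ _ lam).
  by apply: ler_pM; rewrite ?ler_wpM2r ?sqr_ge0// mulr_ge0 ?sqr_ge0.
have bl : lam ^+ 2 * beta <= 1.
  by rewrite mulrA ler_pdivrMr// mul1r natrM.
(* For [j = 0] the second term is absent, and no power of [beta] can be split off. *)
have [j0|jp] := posnP j.
  rewrite j0 !addn0 mul0r addr0 expr1 in x2 *; apply: (le_trans x2).
  rewrite expr0 mulr1 [leRHS](_ : _ = d%:R * n%:R); last first.
    by rewrite natrM; field; rewrite gt_eqF.
  rewrite expr2 -mulrA ler_wpM2l//; move: lb; have := mulr_ge0 (sqr_ge0 lam) (ler0n R d); lra.
have y2 : (j%:R * w e j.-1) ^+ 2 <= d%:R ^+ 2 * beta ^+ j.-1.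
  rewrite (exprMn _ j%:R); apply: ler_pM; rewrite ?sqr_ge0//.
    by rewrite ler_pXn2r ?nnegrE// ler_nat; move: ejd; clear; lia.
  by apply: IH; move: ejd jp; clear; lia.
set x := _ * w e j in x2 *; set y := _ * w e j.-1 in y2 *.
apply: (@le_trans _ _ (2 * (x ^+ 2 + y ^+ 2))).
  by have := sqr_ge0 (x - y); rewrite sqrrB; lra.
apply: (le_trans (ler_wpM2l (ler0n R 2) (lerD x2 y2))).
have bE : beta ^+ j = beta * beta ^+ j.-1 by rewrite -exprS prednK.
rewrite (exprS beta j) bE; set b := beta ^+ j.-1.
rewrite [leRHS](_ : _ = (beta * n%:R) ^+ 2 / 4 * b); last by ring.
rewrite [leLHS](_ : _ = 2 * (d%:R ^+ 2 * b) * (lam ^+ 2 * beta + 1)); last by ring.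
rewrite bn [leRHS](_ : _ = 2 * (d%:R ^+ 2 * b) * (1 + 1)); last by rewrite natrM; field.
by rewrite ler_wpM2l ?lerD2r// mulr_ge0// mulr_ge0 ?sqr_ge0// exprn_ge0.
Qed.

End SmallDegree.
End Bounds.

(** * Harmonic approximation of a monomial *)

Section HarmonicMonomial.
Context {R : realFieldType} {T : finType}.
Implicit Types (A B C S U V : {set T}).
Local Notation n := #|T|.

(* The average of [prod_(i in A) (x_i - x_(b i))] over the injections [b] of [A] into
   its complement. *)
Definition harmonic_monomial A B : R :=
  if #|B| == #|A| then (-1) ^+ #|B :\: A| / 'C(n - #|A|, #|B :\: A|)%:R else 0.

(** With [u = #|U :\: A|] and [N = n - #|A|], adding a point of [A] is possible in [u + 1] ways and
    adding one outside [A] in [N - u] ways. The contributions cancel because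
    [(u + 1) C(N, u + 1) = (N - u) C(N, u)]. *)
Lemma harmonic_monomialP A : (2 * #|A| <= n)%N -> harmonic_coef (harmonic_monomial A).
Proof.
move=> An U; have [UA|UA] := eqVneq #|U|.+1 #|A|; last first.
  apply: big1 => i iU; rewrite /harmonic_monomial cardsU1 iU add1n.
  by rewrite (negbTE UA).
set u := #|U :\: A|; set N := (n - #|A|)%N.
have uA : (u <= #|U|)%N by rewrite subset_leq_card// subsetDl.
have uN : (u < N)%N by rewrite /N; move: uA UA An; clear; lia.
rewrite (bigID (mem A)) /=.
rewrite (eq_bigr (fun=> (-1) ^+ u / 'C(N, u)%:R)) => [|i /andP[iU iA]]; last first.
  rewrite /harmonic_monomial cardsU1 iU add1n UA eqxx setDUl.
  by rewrite (_ : [set i] :\: A = set0) ?set0U//; apply/eqP; rewrite setD_eq0 sub1set.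
rewrite [X in _ + X](eq_bigr (fun=> (-1) ^+ u.+1 / 'C(N, u.+1)%:R)) => [|i /andP[iU iA]]; last first.
  rewrite /harmonic_monomial /harmonic_monomial cardsU1 iU add1n UA eqxx setDUl.
  have -> : [set i] :\: A = [set i].
    by apply/setDidPl; rewrite disjoints1.
  by rewrite cardsU1 inE (negbTE iU) andbF add1n.
rewrite !sumr_const.
have -> : #|(fun i => (i \notin U) && (i \in A))| = u.+1.
  transitivity #|A :\: U|; first by apply: eq_card => i; rewrite [LHS]unfold_in !inE.
  have := cardsID U A; have := cardsID A U; rewrite setIC -/u; move: UA; clear; lia.
have -> : #|(fun i => (i \notin U) && (i \notin A))| = (N - u)%N.
  transitivity #|~: (A :|: U)|.
    by apply: eq_card => i; rewrite [LHS]unfold_in !inE negb_or andbC.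
  have := cardsC (A :|: U); have := cardsUI A U; have := cardsID A U.
  rewrite (setIC U) -/u /N; move: An UA; clear; lia.
have Nu0 : ('C(N, u)%:R : R) != 0 by rewrite pnatr_eq0 -lt0n bin_gt0 ltnW.
have Nu1 : ('C(N, u.+1)%:R : R) != 0 by rewrite pnatr_eq0 -lt0n bin_gt0.
have E : (u.+1)%:R * 'C(N, u.+1)%:R = (N - u)%:R * 'C(N, u)%:R :> R.
  by rewrite -!natrM mul_bin_left.
rewrite -[X in X + _]mulr_natr -[X in _ + X]mulr_natr exprS.
have -> : (N - u)%:R = u.+1%:R * 'C(N, u.+1)%:R / 'C(N, u)%:R :> R by rewrite E mulfK.
by field; rewrite Nu0 Nu1.
Qed.

(** A set [B] of the size of [A] is determined by [U = A :\: B] and a set [B :\: A] of equal size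
    outside [A]; the binomial counts the latter. *)
Lemma sum_card_setD A (f : nat -> R) :
  \sum_(B : {set T} | #|B| == #|A|) f #|B :\: A| =
  \sum_(U : {set T} | U \subset A) 'C(n - #|A|, #|U|)%:R * f #|U|.
Proof.
rewrite (partition_big (fun B => A :\: B) (fun U => U \subset A)) /=; last first.
  by move=> B _; rewrite subsetDl.
apply: eq_bigr => U UA.
have cE B : #|B| == #|A| -> A :\: B == U -> #|B :\: A| = #|U|.
  move=> /eqP BA /eqP <-; have := cardsID A B; have := cardsID B A.
  by rewrite (setIC B) BA; move=> <- /addnI.
rewrite (eq_bigr (fun=> f #|U|)) => [|B /andP[]]; last by move=> h1 h2; rewrite cE.
rewrite sumr_const -[LHS]mulr_natl; congr (_%:R * _).
have -> : (n - #|A|)%N = #|~: A| by rewrite -(cardsC A) addKn.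
rewrite -cards_draws.
have inj : {in [set V : {set T} | V \subset ~: A & #|V| == #|U|] &,
    injective (fun V => (A :\: U) :|: V)}.
  move=> V V'; rewrite !inE => /andP[VA _] /andP[V'A _] /(congr1 (fun X => X :\: A)).
  rewrite !setDUl.
  have -> : A :\: U :\: A = set0.
    by apply/eqP; rewrite setD_eq0 subsetDl.
  by rewrite !set0U (setDidPl _) ?disjoints_subset// (setDidPl _) ?disjoints_subset.
rewrite -(card_in_imset inj) -[LHS]cardsE; congr #|pred_of_set _|.
apply/setP => B; rewrite inE; apply/andP/imsetP.
  move=> [BA BU]; exists (B :\: A).
    by rewrite inE cE// eqxx andbT subDset setUCr subsetT.
  by rewrite -(eqP BU) setDDr setDv set0U setIC -{1}(setID B A).
move=> [V]; rewrite inE => /andP[VA VU] ->.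
have dis : [disjoint A :\: U & V].
  rewrite disjoint_sym disjoints_subset (subset_trans VA)// setCS subsetDl.
  by [].
split.
  rewrite cardsU (eqP (_ : _ :&: _ == set0)) ?setI_eq0// cards0 subn0 (eqP VU).
  by rewrite -(cardsID U A) (setIidPr UA) addnC.
apply/eqP; rewrite setDUr setDDr setDv set0U (setIidPr UA).
have -> : A :\: V = A by apply/setDidPl; rewrite disjoint_sym disjoints_subset.
by apply/setIidPl.
Qed.

(** The coefficient at [B = A] is exactly [1]. Each other [U] stands for ['C(n - #|A|, #|U|)] sets,
    each contributing the inverse square of that number. *)
Lemma harmonic_monomial_dist A :
  (2 * #|A| <= n)%N ->
  \sum_(B : {set T}) ((A == B)%:R - harmonic_monomial A B) ^+ 2 =
  \sum_(U : {set T} | (U \subset A) && (U != set0)) 'C(n - #|A|, #|U|)%:R^-1.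
Proof.
move=> An; pose f u : R := if u == 0%N then 0 else 'C(n - #|A|, u)%:R ^- 2.
transitivity (\sum_(B : {set T} | #|B| == #|A|) f #|B :\: A|).
  rewrite [RHS]big_mkcond; apply: eq_bigr => B _; rewrite /harmonic_monomial /f.
  case: (eqVneq #|B| #|A|) => [BA|]; last first.
    by case: (eqVneq A B) => [->|_]; rewrite ?eqxx// subr0 expr0n.
  rewrite cards_eq0 setD_eq0; case: (boolP (B \subset A)) => BsA.
    have/eqP -> : B == A by rewrite eqEcard BsA BA leqnn.
    by rewrite eqxx setDv cards0 bin0 divr1 expr0 subrr expr0n.
  case: (eqVneq A B) => [E|_]; first by rewrite E subxx in BsA.
  by rewrite sub0r sqrrN exprMn exprVn sqrr_sign mul1r.
rewrite sum_card_setD big_mkcondr; apply: eq_bigr => U UA; rewrite /f cards_eq0.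
case: eqP => [|_] /=; first by rewrite mulr0.
have C0 : ('C(n - #|A|, #|U|)%:R : R) != 0.
  rewrite pnatr_eq0 -lt0n bin_gt0; have := subset_leq_card UA; move: An; clear; lia.
by field.
Qed.

(** From [u! <= d^u] and [n - a - i >= n / 2] the ratio [2 d / n] would follow; [4 d / n] matches
    the decay rate of the umbral weights. *)
Lemma binV_le (d a u : nat) : (4 * d <= n)%N -> (0 < n)%N -> (u <= a)%N -> (a <= d)%N ->
  'C(n - a, u)%:R^-1 <= ((4 * d)%:R / n%:R : R) ^+ u.
Proof.
move=> dn n0 ua ad.
have B0 : (0 < 'C(n - a, u))%N by rewrite bin_gt0; lia.
rewrite -[leLHS]mul1r ler_pdivrMr ?ltr0n// exprMn exprVn mulrAC ler_pdivlMr ?exprn_gt0 ?ltr0n//.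
rewrite mul1r -!natrX -natrM ler_nat.
have h1 : (u`! <= d ^ u)%N.
  rewrite -ffactnn ffact_prod -[X in (_ <= _ ^ X)%N]card_ord -prod_nat_const.
  by apply: leq_prod => i _; lia.
have h2 : (n ^ u <= 2 ^ u * (n - a) ^_ u)%N.
  rewrite ffact_prod -[X in (_ ^ X <= _)%N]card_ord -[X in (2 ^ X)%N]card_ord -!prod_nat_const -big_split /=.
  by apply: leq_prod => i _; have := ltn_ord i; move: (nat_of_ord i) dn ua ad; clear => m; move: #|T| => N; lia.
rewrite -bin_ffact in h2; apply: (leq_trans h2).
rewrite mulnCA [leqRHS]mulnC leq_mul2l; apply/orP; right.
apply: (@leq_trans (2 ^ u * d ^ u)); first by rewrite leq_mul2l h1 orbT.
by rewrite -expnMn; case: u {ua B0 h1 h2} => // u; rewrite leq_exp2r// leq_mul2r orbT.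
Qed.

End HarmonicMonomial.

(** * Few variables *)

Section Distance.
Context {R : realFieldType} {T : finType}.
Implicit Types (F G H : {set T} -> R) (A B C X S : {set T}).

Definition sqnorm F : R := \sum_(A : {set T}) F A ^+ 2.

Lemma sqnorm_ge0 F : 0 <= sqnorm F.
Proof. by apply: sumr_ge0 => A _; rewrite sqr_ge0. Qed.

Lemma sqnormD_le F G : sqnorm (fun B => F B + G B) <= 2 * sqnorm F + 2 * sqnorm G.
Proof.
rewrite /sqnorm !mulr_sumr -big_split; apply: ler_sum => B _ /=.
by have := sqr_ge0 (F B - G B); rewrite sqrrB sqrrD; lra.
Qed.

(** Cauchy-Schwarz over the subsets of [S], whose number is the origin of [2 ^ d] for small
    degree. *)
Lemma sqnorm_mul_le F S (K : {set T} -> {set T} -> R) (c : R) :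
  (forall A, ~~ (A \subset S) -> F A = 0) ->
  (forall A, A \subset S -> \sum_(B : {set T}) K A B ^+ 2 <= c) ->
  sqnorm (fun B => \sum_(A : {set T}) F A * K A B) <= 2 ^+ #|S| * c * sqnorm F.
Proof.
move=> FS Kc.
have -> : 2 ^+ #|S| * c = \sum_(A in powerset S) c.
  by rewrite sumr_const card_powerset -natrX mulr_natl.
have h B : (\sum_(A : {set T}) F A * K A B) ^+ 2 <=
           sqnorm F * \sum_(A in powerset S) K A B ^+ 2.
  have -> : \sum_(A : {set T}) F A * K A B = \sum_(A in powerset S) F A * K A B.
    rewrite [RHS]big_mkcond; apply: eq_bigr => A _; rewrite powersetE.
    by case: ifP => // /negbT/FS ->; rewrite mul0r.
  apply: (le_trans (cauchy_schwarz_sum _ _ _)); apply: ler_wpM2r.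
    by apply: sumr_ge0 => A _; rewrite sqr_ge0.
  rewrite /sqnorm [leRHS](bigID (mem (powerset S))) /= lerDl.
  by apply: sumr_ge0 => A _; rewrite sqr_ge0.
apply: (le_trans (ler_sum _ (fun B _ => h B))).
rewrite -mulr_sumr mulrC ler_wpM2r ?sqnorm_ge0// exchange_big /=.
by apply: ler_sum => A; rewrite powersetE => /Kc.
Qed.

Lemma exp1D_le (x : R) a : 0 <= x -> 2 * a%:R * x <= 1 -> (1 + x) ^+ a - 1 <= 2 * a%:R * x.
Proof.
move=> x0; elim: a => [|a IH]; first by rewrite expr0 subrr mulr0 mul0r.
rewrite -natr1 => ax; have ax' : 2 * a%:R * x <= 1 by move: ax x0; lra.
have {}IH := IH ax'; rewrite exprS.
have : (1 + x) * ((1 + x) ^+ a - 1) <= (1 + x) * (2 * a%:R * x).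
  by rewrite ler_wpM2l// addr_ge0.
have : x * (2 * a%:R * x) <= x * 1 by rewrite ler_wpM2l.
set y := (1 + x) ^+ a; lra.
Qed.

Variables (k : nat) (p s : R).
Local Notation n := #|T|.
Local Notation chaos := (chaos_sum p s).
Local Notation w := (@psi_ratio R T k p s).
Local Notation umb := (@umbral_coef R T k p s).
Hypothesis p0 : 0 < p.
Hypothesis p2 : p * 2 <= 1.
Hypothesis s0 : 0 < s.
Hypothesis s2 : s ^+ 2 = p * (1 - p).
Hypothesis pn : p * n%:R = k%:R.
Hypothesis kn : (2 * k <= n)%N.
Hypothesis n0 : (0 < n)%N.

Variables (F G : {set T} -> R) (S : {set T}).
Hypothesis hG : harmonic_coef G.
Hypothesis lG : coef_deg_le k G.
Hypothesis FG : forall X, #|X| = k -> chaos F X = chaos G X.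
Hypothesis FS : forall A, ~~ (A \subset S) -> F A = 0.
Local Notation d := #|S|.
Hypothesis dk : (d <= k)%N.

Section SmallDegree.
Hypothesis d2n : (4 * d ^ 2)%:R <= s ^+ 2 * n%:R.
Local Notation beta := ((4 * d)%:R / n%:R : R).

Let nR0 : 0 < (n%:R : R). Proof. by rewrite ltr0n. Qed.

Let beta0 : 0 <= beta. Proof. by rewrite divr_ge0. Qed.

Let dbeta : 2 * d%:R * beta <= 1.
Proof.
rewrite mulrA ler_pdivrMr// mul1r.
rewrite (_ : 2 * d%:R * (4 * d)%:R = 2 * (4 * d ^ 2)%:R); last by rewrite !natrM; ring.
have h := d2n; have s1 : s ^+ 2 <= 4^-1.
  by rewrite s2; have := sqr_ge0 (p - 2^-1); rewrite expr2; lra.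
have : s ^+ 2 * n%:R <= 4^-1 * n%:R by rewrite ler_wpM2r.
have := nR0; move: h; lra.
Qed.

Let d4n : (4 * d <= n)%N.
Proof.
case: (posnP d) => [->|dp]; first by rewrite muln0.
have : (1 : R) <= 2 * d%:R by rewrite -natrM ler1n; lia.
move=> h; have : beta <= 1.
  by apply: le_trans dbeta; rewrite -[leLHS]mul1r ler_wpM2r.
by rewrite ler_pdivrMr// mul1r ler_nat.
Qed.

(** The sum is [(1 + beta) ^+ #|A| - 1]. It bounds the row of [A] in both error kernels below, whose
    diagonal entries vanish. *)
Let subset_sum A : A \subset S ->
  \sum_(B : {set T} | (B \subset A) && (B != A)) beta ^+ #|A :\: B| <= 2 * d%:R * beta.
Proof.
move=> AS; have := sum_subset_exp beta A.
rewrite (bigD1 A)//= setDv cards0 expr0 => /(canRL (addKr _)) ->; rewrite addrC.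
have Ad := subset_leq_card AS.
have Ab : 2 * #|A|%:R * beta <= 2 * d%:R * beta.
  by rewrite ler_wpM2r// ler_wpM2l// ler_nat.
by apply: (le_trans _ Ab); apply: exp1D_le => //; exact: le_trans Ab dbeta.
Qed.

Lemma sqnorm_umbral_coef_sub :
  sqnorm (fun B => F B - umb F B) <= 2 ^+ d * (2 * d%:R * beta) * sqnorm F.
Proof.
pose K A B := (A == B)%:R - (if B \subset A then w #|B| #|A :\: B| else 0).
have -> : sqnorm (fun B => F B - umb F B) = sqnorm (fun B => \sum_(A : {set T}) F A * K A B).
  apply: eq_bigr => B _; congr (_ ^+ 2); rewrite /K.
  under [RHS]eq_bigr => A _ do rewrite mulrBr.
  rewrite sumrB; congr (_ - _).
    rewrite (bigD1 B)//= eqxx mulr1 big1 ?addr0// => A /negbTE ->.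
    by rewrite mulr0.
  rewrite /umbral_coef big_mkcond; apply: eq_bigr => A _.
  by case: ifP => //; rewrite mulr0.
apply: sqnorm_mul_le => // A AS; apply: le_trans (subset_sum AS).
have Ad := subset_leq_card AS.
rewrite [leRHS]big_mkcond; apply: ler_sum => B _; rewrite /K.
have [BA|BA] := boolP (B \subset A) => /=; last first.
  rewrite subr0; case: eqVneq => [E|]; first by rewrite E subxx in BA.
  by rewrite expr0n.
have [->|BnA] := eqVneq B A => /=.
  by rewrite setDv cards0 (psi_ratio0 s0 s2 pn kn) ?eqxx ?subrr ?expr0n// (leq_trans Ad).
rewrite sub0r sqrrN.
apply: (psi_ratio_sq_le p0 p2 s0 s2 pn kn dk d2n n0).
by rewrite cardsDS// subnKC// subset_leq_card.
Qed.

Definition harmonic_approx B := \sum_(A : {set T}) F A * harmonic_monomial A B.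

Lemma sqnorm_harmonic_approx :
  sqnorm (fun B => F B - harmonic_approx B) <= 2 ^+ d * (2 * d%:R * beta) * sqnorm F.
Proof.
pose K A B : R := (A == B)%:R - harmonic_monomial A B.
have -> : sqnorm (fun B => F B - harmonic_approx B) =
    sqnorm (fun B => \sum_(A : {set T}) F A * K A B).
  apply: eq_bigr => B _; congr (_ ^+ 2); rewrite /K.
  under [RHS]eq_bigr => A _ do rewrite mulrBr.
  rewrite sumrB; congr (_ - _).
  rewrite (bigD1 B)//= eqxx mulr1 big1 ?addr0// => A /negbTE ->.
  by rewrite mulr0.
apply: sqnorm_mul_le => // A AS; have Ad := subset_leq_card AS.
rewrite harmonic_monomial_dist; last by move: Ad d4n; clear; lia.
apply: le_trans (subset_sum AS).
(* Substituting [U = A :\: B] turns nonempty [U] into proper subsets [B], as in [subset_sum]. *)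
rewrite (reindex_onto (fun B => A :\: B) (fun B => A :\: B)) /=; last first.
  by move=> B /andP[BA _]; rewrite setDDr setDv set0U (setIidPr BA).
rewrite (eq_bigl (fun B => (B \subset A) && (B != A))); last first.
  move=> B; rewrite subsetDl setDDr setDv set0U setD_eq0 /=.
  rewrite andbC; have [BA|BA] := boolP (B \subset A).
    by rewrite (setIidPr BA) eqxx eqEsubset BA.
  by apply/negP => /andP[/eqP E]; rewrite -E subsetIl in BA.
apply: ler_sum => B _; apply: binV_le => //.
by rewrite subset_leq_card// subsetDl.
Qed.

Lemma dist_small_degree :
  sqnorm (fun B => F B - G B) <= 80 * (2 ^+ d * (d%:R ^+ 2 / n%:R)) * sqnorm F.
Proof.
pose H := harmonic_approx.
have lF A : (k < #|A|)%N -> F A = 0.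
  by move=> kA; apply: FS; apply/negP => /subset_leq_card; move: kA dk; clear; lia.
have hH : harmonic_coef H.
  move=> U; rewrite exchange_big big1// => A _; rewrite -mulr_sumr.
  have [Ak|/lF ->] := leqP #|A| k; last by rewrite mul0r.
  by rewrite harmonic_monomialP ?mulr0//; move: Ak kn; clear; lia.
have lH : coef_deg_le k H.
  move=> B Bk; apply: big1 => A _; rewrite /harmonic_monomial.
  by case: eqP => [E|]; rewrite ?mulr0// lF ?mul0r -?E.
pose D B := H B - G B.
have hD : harmonic_coef D by move=> U; rewrite sumrB hH hG subrr.
have lD : coef_deg_le k D by move=> B Bk; rewrite /D lH// lG// subrr.
have := umbral_coef_orthogonal s0 s2 pn kn hG FG hD lD => orth.
(* Being harmonic, [D] is orthogonal to [umb F - G], so [sqnorm D] is the product of [D] with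
   [H - umb F]. *)
have DH : sqnorm D <= sqnorm (fun B => H B - umb F B).
  have : sqnorm D = \sum_(B : {set T}) D B * (H B - umb F B).
    rewrite -[RHS]addr0 -[X in _ = _ + X]orth -big_split; apply: eq_bigr => B _ /=.
    by rewrite /D; ring.
  have : 2 * \sum_(B : {set T}) D B * (H B - umb F B) <= sqnorm D + sqnorm (fun B => H B - umb F B).
    rewrite /sqnorm mulr_sumr -big_split; apply: ler_sum => B _ /=.
    by have := sqr_ge0 (D B - (H B - umb F B)); rewrite sqrrB; lra.
  by move=> h1 h2; move: h1; rewrite -h2; lra.
have E1 := sqnormD_le (fun B => F B - H B) D.
have E2 := sqnormD_le (fun B => H B - F B) (fun B => F B - umb F B).
have -> : sqnorm (fun B => F B - G B) = sqnorm (fun B => F B - H B + D B).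
  by apply: eq_bigr => B _; congr (_ ^+ 2); rewrite /D; ring.
have E3 : sqnorm (fun B => H B - umb F B) = sqnorm (fun B => H B - F B + (F B - umb F B)).
  by apply: eq_bigr => B _; congr (_ ^+ 2); ring.
have E4 : sqnorm (fun B => H B - F B) = sqnorm (fun B => F B - H B).
  by apply: eq_bigr => B _; rewrite -sqrrN opprB.
have E5 := sqnorm_umbral_coef_sub; have E6 := sqnorm_harmonic_approx.
(* The error [F - H] costs [2], and [D] costs [2 * (2 + 2)], in total [10]; the remaining [8] comes
   from [2 * d * beta]. *)
rewrite (_ : 80 * _ * _ = 10 * (2 ^+ d * (2 * d%:R * beta) * sqnorm F)); last first.
  by rewrite natrM; ring.
rewrite -/H in E6; move: E1 E2 DH E5 E6; rewrite E3 E4; lra.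
Qed.

End SmallDegree.

End Distance.

(** * Comparison of the slice with the cube *)

(** The last factors of [k ^_ e] may be as small as about [k / 4], so the factors [i] and
    [e - 1 - i] are paired: their product is at least [k (k - e + 1)], hence at least [k^2 / 4]. *)
Lemma expn_le_ffact k e : (4 * e <= 3 * k)%N -> (k ^ e <= 2 ^ e * k ^_ e)%N.
Proof.
move=> ek; rewrite -leq_sqr expnMn.
have -> : ((k ^_ e) ^ 2 = \prod_(i < e) ((k - i) * (k - (e - i.+1))))%N.
  rewrite -mulnn !ffact_prod [X in (X * _)%N](reindex_inj rev_ord_inj) /=.
  rewrite -big_split /=; apply: eq_bigr => i _. exact: mulnC.
rewrite (expnAC k) (expnAC 2).
rewrite -[X in (_ ^ X <= _)%N]card_ord -[X in (_ <= _ ^ X * _)%N]card_ord -!prod_nat_const.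
rewrite -big_split /=; apply: leq_prod => i _; have := ltn_ord i.
move: (nat_of_ord i) ek; clear => m ek me; nia.
Qed.

Lemma expn_ffact_le n d e : (e <= d)%N -> (2 * d <= n)%N ->
  (n ^ d * n ^_ e <= 2 ^ (d - e) * n ^ e * n ^_ d)%N.
Proof.
elim: d => [|d IH]; first by rewrite leqn0 => /eqP ->; rewrite subnn mul1n.
rewrite leq_eqVlt => /orP[/eqP -> _|]; first by rewrite subnn mul1n.
rewrite ltnS => ed dn; rewrite subSn// !expnS ffactnSr.
have {}IH : (n ^ d * n ^_ e <= 2 ^ (d - e) * n ^ e * n ^_ d)%N by apply: IH => //; lia.
rewrite -mulnA [leqRHS](_ : _ = (2 * (n - d)) * (2 ^ (d - e) * n ^ e * n ^_ d))%N; last by ring.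
by apply: leq_mul => //; lia.
Qed.

(** The hypergeometric probability that a random [k]-set meets a given [d]-set in a given
    [z]-subset, in falling factorials, ready for comparison with powers. *)
Lemma bin_sub_ffact n k d z : (z <= d)%N -> (z <= k)%N -> (d - z <= n - k)%N -> (k <= n)%N ->
  ('C(n - d, k - z) * n ^_ d = 'C(n, k) * (k ^_ z * (n - k) ^_ (d - z)))%N.
Proof.
move=> zd zk dz kn.
have e1 : ((n - d) - (k - z) = (n - k) - (d - z))%N by lia.
have : (k - z <= n - d)%N by lia.
move=> /bin_fact; rewrite e1 => E1.
have E2 := bin_fact kn; have E3 := @ffact_fact n d ltac:(lia).
have E4 := ffact_fact zk; have E5 := ffact_fact dz.
apply/eqP; rewrite -(@eqn_pmul2r ((k - z)`! * (n - k - (d - z))`!)) ?muln_gt0 ?fact_gt0//.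
apply/eqP; transitivity (n`!); first by rewrite -E3 -E1; ring.
by rewrite -E2 -E4 -E5; ring.
Qed.

Lemma exp5_le d q : (4 * q <= d)%N -> (5 ^ q * 5 ^ d <= 8 ^ d)%N.
Proof.
move=> /subnKC <-; rewrite !(expnD _ (4 * q)) !(expnM _ 4) mulnA -expnMn.
have h (a b m : nat) : (a <= b -> a ^ m <= b ^ m)%N.
  by case: m => // m ab; rewrite leq_exp2r.
by apply: leq_mul; apply: h.
Qed.

Section CubeAverage.
Context {R : realFieldType} {T : finType}.
Implicit Types (F G H : {set T} -> R) (A B C X Z S : {set T}).
Local Notation n := #|T|.
Variables (p s : R).
Local Notation chaos := (chaos_sum p s).
Local Notation om := (std_coord p s).

Definition cube_avg (f : {set T} -> R) : R :=
  \sum_(X : {set T}) (\prod_i (if i \in X then p else 1 - p)) * f X.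

Lemma cube_avg_prod (u v : T -> R) :
  cube_avg (fun X => \prod_i (if i \in X then u i else v i)) =
  \prod_i (p * u i + (1 - p) * v i).
Proof.
rewrite bigA_distr; apply: eq_bigr => X _; rewrite -big_split.
by apply: eq_bigr => i _; case: ifP.
Qed.

Hypothesis s0 : s != 0.
Hypothesis s2 : s ^+ 2 = p * (1 - p).

Lemma cube_avg_std_coord A B :
  cube_avg (fun X => (\prod_(i in A) om X i) * \prod_(i in B) om X i) = (A == B)%:R.
Proof.
pose f (x : R) i := (if i \in A then (x - p) / s else 1) * (if i \in B then (x - p) / s else 1).
transitivity (cube_avg (fun X => \prod_i (if i \in X then f 1 i else f 0 i))).
  apply: eq_bigr => X _; congr (_ * _).
  rewrite [X in X * _]big_mkcond [X in _ * X = _]big_mkcond -big_split; apply: eq_bigr => i _ /=.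
  by rewrite /std_coord /f; case: (i \in X).
rewrite cube_avg_prod; have [AB|/eqP AB] := eqVneq A B.
  apply: big1 => i _; rewrite /f AB; case: ifP => _; last by ring.
  by field: s2; exact: s0.
have [i iAB] : exists i, (i \in A) != (i \in B).
  apply/existsP; rewrite -negb_forall; apply/negP => /forallP h.
  by apply: AB; apply/setP => i; apply/eqP; have := h i.
rewrite (bigD1 i)//= (_ : p * _ + _ = 0) ?mul0r// /f.
by move: iAB; case: (i \in A); case: (i \in B) => // _; field; exact: s0.
Qed.

Lemma cube_avg_chaos_sq F : cube_avg (fun X => chaos F X ^+ 2) = sqnorm F.
Proof.
transitivity (\sum_(A : {set T}) \sum_(B : {set T}) F A * F B *
    cube_avg (fun X => (\prod_(i in A) om X i) * \prod_(i in B) om X i)).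
  rewrite /cube_avg; under [RHS]eq_bigr => A _ do under eq_bigr => B _ do rewrite mulr_sumr.
  under [RHS]eq_bigr => A _ do rewrite exchange_big.
  rewrite exchange_big; apply: eq_bigr => X _ /=.
  rewrite expr2 /chaos_sum big_distrlr mulr_sumr; apply: eq_bigr => A _ /=.
  by rewrite mulr_sumr; apply: eq_bigr => B _; ring.
apply: eq_bigr => A _; rewrite (bigD1 A)//= cube_avg_std_coord eqxx mulr1 -expr2.
rewrite big1 ?addr0// => B /negbTE BA.
by rewrite cube_avg_std_coord eq_sym BA mulr0.
Qed.

End CubeAverage.

(** * Marginals of the slice and of the cube on the coordinates in [S] *)

Section Marginals.
Context {R : realFieldType} {T : finType}.
Implicit Types (X Z : {set T}).
Local Notation n := #|T|.
Variables (k : nat) (p : R) (S : {set T}).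
Hypothesis pn : p * n%:R = k%:R.
Hypothesis kn : (2 * k <= n)%N.
Local Notation d := #|S|.
Hypothesis dk : (d <= k)%N.

(** The indicator of [X :&: S = Z], as a product over coordinates so that both averages can be
    computed by product formulas. *)
Let marg Z X : R := \prod_i (if i \in X then (if i \in S then (i \in Z)%:R else 1)
                                    else (if i \in S then (i \notin Z)%:R else 1)).

Let margE Z X : Z \subset S -> marg Z X = (X :&: S == Z)%:R.
Proof.
move=> ZS; have [<-|/eqP XZ] := eqVneq (X :&: S) Z.
  by apply: big1 => i _; rewrite inE; case: (i \in X); case: (i \in S).
have [i iXZ] : exists i, (i \in X :&: S) != (i \in Z).
  apply/existsP; rewrite -negb_forall; apply/negP => /forallP h.
  by apply: XZ; apply/setP => i; apply/eqP; have := h i.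
rewrite /marg (bigD1 i)//=; move: iXZ; rewrite inE.
have [iS|iS] := boolP (i \in S); last first.
  by rewrite andbF (contraNF (subsetP ZS i)).
by case: (i \in X); case: (i \in Z); rewrite ?mul0r.
Qed.

(** It suffices to compare the probabilities of each trace [Z] on [S]. With [z = #|Z|], they are
    [k ^_ z (n - k) ^_ (d - z) / n ^_ d] and [k^z (n - k)^(d - z) / n^d], and falling factorials are
    at most powers. *)
Lemma slice_avg_le_cube_avg (f : {set T} -> R) :
  (forall X, 0 <= f X) -> (forall X, f X = f (X :&: S)) ->
  slice_avg k f * (n ^_ d)%:R <= (n ^ d)%:R * cube_avg p f.
Proof.
move=> f0 fS.
have fE X : f X = \sum_(Z in powerset S) f Z * marg Z X.
  rewrite (bigD1 (X :&: S)) ?powersetE ?subsetIr//= margE ?subsetIr// eqxx mulr1 -fS.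
  by rewrite big1 ?addr0// => Z /andP[]; rewrite powersetE eq_sym => /margE -> /negbTE ->; rewrite mulr0.
have -> : slice_avg k f = \sum_(Z in powerset S) f Z * slice_avg k (marg Z).
  by rewrite -slice_avg_sum; apply: eq_slice_avg => X _.
have -> : cube_avg p f = \sum_(Z in powerset S) f Z * cube_avg p (marg Z).
  rewrite /cube_avg; under [RHS]eq_bigr => Z _ do rewrite mulr_sumr.
  rewrite exchange_big; apply: eq_bigr => X _ /=.
  by rewrite fE mulr_sumr; apply: eq_bigr => Z _; ring.
rewrite mulr_suml mulr_sumr; apply: ler_sum => Z; rewrite powersetE => ZS.
rewrite -mulrA [leRHS]mulrCA ler_wpM2l//.
have zd := subset_leq_card ZS.
have -> : cube_avg p (marg Z) = p ^+ #|Z| * (1 - p) ^+ (d - #|Z|).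
  rewrite cube_avg_prod.
  transitivity (\prod_i ((if i \in Z then p else 1) * (if i \in S :\: Z then 1 - p else 1))).
    apply: eq_bigr => i _; rewrite inE; have [iS|iS] := boolP (i \in S).
      by case: (i \in Z) => /=; ring.
    by rewrite (contraNF (subsetP ZS i) iS) /=; ring.
  by rewrite big_split -!big_mkcond !prodr_const cardsDS.
have -> : slice_avg k (marg Z) = 'C(n - d, k - #|Z|)%:R / 'C(n, k)%:R.
  rewrite /slice_avg sum_slice_prod; congr (_ / _).
  transitivity (('X^#|Z| * (1 + 'X) ^+ (n - d) : {poly R})`_k).
    congr ((polyseq _)`_k).
    transitivity (\prod_i ((if i \in Z then 'X else 1) * (if i \in ~: S then 1 + 'X else 1) : {poly R})).
      apply: eq_bigr => i _; rewrite inE; have [iS|iS] := boolP (i \in S) => /=.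
        by case: (i \in Z) => /=; rewrite ?scale1r ?scale0r ?polyC0 ?polyC1 ?addr0 ?add0r mulr1.
      by rewrite (contraNF (subsetP ZS i) iS) /= scale1r mul1r addrC.
    by rewrite big_split -!big_mkcond !prodr_const -[in RHS](cardsC S) addKn.
  rewrite coefXnM ltnNge (leq_trans zd dk) /= exprDn coef_sum.
  under eq_bigr => i _ do rewrite expr1n mul1r coefMn coefXn.
  have kzn : (k - #|Z| < (n - d).+1)%N by lia.
  rewrite (bigD1 (Ordinal kzn))//= eqxx big1 ?addr0// => i.
  by rewrite -val_eqE eq_sym => /negbTE /= ->; rewrite mul0rn.
have kn' : (k <= n)%N by lia.
have C0 : ('C(n, k)%:R : R) != 0 by rewrite pnatr_eq0 -lt0n bin_gt0.
rewrite mulrAC -natrM (bin_sub_ffact zd (leq_trans zd dk) _ kn'); last by lia.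
rewrite natrM mulrAC divff// mul1r.
have -> : (n ^ d)%:R * (p ^+ #|Z| * (1 - p) ^+ (d - #|Z|)) = k%:R ^+ #|Z| * (n - k)%:R ^+ (d - #|Z|) :> R.
  rewrite natrB// -pn (_ : n%:R - p * n%:R = (1 - p) * n%:R); last by ring.
  by rewrite !exprMn natrX -{1}(subnKC zd) exprD; ring.
have ffle a b : (a ^_ b <= a ^ b)%N.
  rewrite ffact_prod -[X in (_ <= _ ^ X)%N]card_ord -prod_nat_const.
  by apply: leq_prod => i _; exact: leq_subr.
by rewrite -!natrX -natrM ler_nat leq_mul.
Qed.

End Marginals.

(** * Many variables *)

Section Distance.
Context {R : realFieldType} {T : finType}.
Implicit Types (F G H : {set T} -> R) (A B C X S : {set T}).
Variables (k : nat) (p s : R).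
Local Notation n := #|T|.
Local Notation chaos := (chaos_sum p s).
Local Notation w := (@psi_ratio R T k p s).
Local Notation kappa := (@level_factor R T k p s).
Local Notation umb := (@umbral_coef R T k p s).
Hypothesis p0 : 0 < p.
Hypothesis p2 : p * 2 <= 1.
Hypothesis s0 : 0 < s.
Hypothesis s2 : s ^+ 2 = p * (1 - p).
Hypothesis pn : p * n%:R = k%:R.
Hypothesis kn : (2 * k <= n)%N.
Hypothesis n0 : (0 < n)%N.

Let nR0 : 0 < (n%:R : R). Proof. by rewrite ltr0n. Qed.

(** By induction: [kappa e.+1 / kappa e] is at least [n (k - e) / (k (n - e))], which after
    cancellation reads [(n - k) (n - 2 e) (n - 2 e - 1) <= n (n - k - e) (n - e)]. *)
Lemma level_factor_ge e : (e <= k)%N ->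
  (n ^ e * k ^_ e)%:R <= kappa e * (k ^ e * n ^_ e)%:R.
Proof.
elim: e => [|e IH] ek; first by rewrite (level_factor0 p s kn) mul1r.
have {}IH := IH (ltnW ek).
have kR : (0 : R) < k%:R - e%:R by rewrite subr_gt0 ltr_nat.
have nk : (0 : R) < n%:R - k%:R - e%:R.
  by rewrite subr_gt0 ltrBrDr -natrD ltr_nat; move: ek kn; clear; lia.
have e1 : (0 : R) < n%:R - 2 * e%:R.
  by rewrite subr_gt0 -natrM ltr_nat; move: ek kn; clear; lia.
have e2 : (0 : R) < n%:R - 2 * e%:R - 1.
  rewrite (_ : _ - 1 = (n - 2 * e - 1)%:R) ?ltr0n; first by move: ek kn; clear; lia.
  by rewrite !natrB ?natrM//; move: ek kn; clear; lia.
have ke : (e%:R : R) <= k%:R by rewrite ler_nat ltnW.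
have nkR : 2 * (k%:R : R) <= n%:R by rewrite -natrM ler_nat.
rewrite (level_factor_succ s0 s2 pn kn ek) !expnS !ffactnSr !natrM !natrB ?(ltnW ek)//; last first.
  by move: ek kn; clear; lia.
set r := _ / _.
have r0 : 0 <= r by rewrite divr_ge0 ?mulr_ge0 ?sqr_ge0// ltW.
have rP : n%:R * (k%:R - e%:R) <= r * (k%:R * (n%:R - e%:R)).
  rewrite /r mulrAC ler_pdivlMr ?mulr_gt0 ?exprn_gt0//.
  have -> : s ^+ 2 = k%:R * (n%:R - k%:R) / n%:R ^+ 2.
    by rewrite s2 -pn; field; rewrite gt_eqF.
  rewrite [leLHS](_ : _ = (k%:R - e%:R) * (k%:R / n%:R) *
     ((n%:R - k%:R) * (n%:R - 2 * e%:R) * (n%:R - 2 * e%:R - 1))); last first.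
    by field; rewrite gt_eqF.
  rewrite [leRHS](_ : _ = (k%:R - e%:R) * (k%:R / n%:R) *
     (n%:R * (n%:R - k%:R - e%:R) * (n%:R - e%:R))); last first.
    by field; rewrite gt_eqF.
  apply: ler_wpM2l; first by rewrite mulr_ge0 ?divr_ge0// ltW.
  have h : (n%:R - k%:R) * (n%:R - 2 * e%:R) * (n%:R - 2 * e%:R - 1) <=
      (n%:R - k%:R) * (n%:R - 2 * e%:R) * (n%:R - 2 * e%:R) :> R.
    by apply: ler_wpM2l; [rewrite mulr_ge0//; move: nk ke e1 nkR; have := ler0n R e; lra|lra].
  apply: (le_trans h); rewrite -subr_ge0.
  (* A form in which nonnegativity is visible, as [e] and [k] are at most [n / 2]. *)
  rewrite (_ : _ - _ = e%:R * (n%:R / 2 * (n%:R - 2 * k%:R) + (n%:R / 2 - e%:R) * (3 * n%:R - 4 * k%:R))); last by field.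
  have nR : (0 : R) < n%:R := nR0.
  by apply: mulr_ge0 => //; apply: addr_ge0; apply: mulr_ge0; lra.
apply: (@le_trans _ _ ((n ^ e * k ^_ e)%:R * (r * (k%:R * (n%:R - e%:R))))).
  rewrite natrM [leLHS](_ : _ = (n ^ e)%:R * (k ^_ e)%:R * (n%:R * (k%:R - e%:R))); last by ring.
  by rewrite ler_wpM2l// mulr_ge0.
have : (n ^ e * k ^_ e)%:R * (r * (k%:R * (n%:R - e%:R))) <=
   kappa e * (k ^ e * n ^_ e)%:R * (r * (k%:R * (n%:R - e%:R))).
  by apply: ler_wpM2r => //; rewrite mulr_ge0// mulr_ge0//; move: e1; have := ler0n R e; lra.
move=> h; apply: (le_trans h); rewrite natrM le_eqVlt; apply/orP; left; apply/eqP; ring.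
Qed.

(** A factor [2^e] is lost in [kappa e >= 2^-e * n^e / n ^_ e], and [2^(d - e)] in replacing
    [n^e / n ^_ e] by [n^d / n ^_ d]. *)
Lemma level_factor_level_ge (d e : nat) : (d <= k)%N -> (4 * e <= 3 * d)%N ->
  (n ^ d)%:R <= 2 ^+ d * kappa e * (n ^_ d)%:R.
Proof.
move=> dk ed.
have ek : (e <= k)%N by move: dk ed; clear; lia.
have ed' : (e <= d)%N by move: ed; clear; lia.
have dn : (2 * d <= n)%N by move: kn dk; clear; lia.
have kap := level_factor_gt0 s0 s2 pn kn ek.
have h1 := level_factor_ge ek.
have h2 : (k ^ e <= 2 ^ e * k ^_ e)%N by apply: expn_le_ffact; move: ed dk; clear; lia.
have h3 := expn_ffact_le ed' dn.
have kf : (0 : R) < (k ^_ e)%:R by rewrite ltr0n ffact_gt0.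
have nf : (0 : R) < (n ^_ e)%:R by rewrite ltr0n ffact_gt0; move: ek kn; clear; lia.
have h4 : (n ^ e)%:R <= kappa e * (2 ^ e * n ^_ e)%:R.
  rewrite -(ler_pM2r kf) -natrM; apply: (le_trans h1).
  rewrite -mulrA ler_pM2l// -natrM ler_nat.
  by rewrite mulnAC leq_mul2r h2 orbT.
rewrite -(ler_pM2r nf) -natrM.
apply: (@le_trans _ _ (2 ^ (d - e) * n ^ e * n ^_ d)%:R); first by rewrite ler_nat.
have -> : 2 ^+ d = (2 ^ e)%:R * (2 ^ (d - e))%:R :> R by rewrite -natrM -expnD subnKC// natrX.
rewrite !natrM [leLHS](_ : _ = (2 ^ (d - e))%:R * (n ^_ d)%:R * (n ^ e)%:R); last by ring.
rewrite [leRHS](_ : _ = (2 ^ (d - e))%:R * (n ^_ d)%:R * (kappa e * (2 ^ e * n ^_ e)%:R)); last first.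
  by rewrite [in RHS]natrM; ring.
by rewrite ler_wpM2l// mulr_ge0.
Qed.

Variables (F G : {set T} -> R) (S : {set T}).
Hypothesis hG : harmonic_coef G.
Hypothesis lG : coef_deg_le k G.
Hypothesis FG : forall X, #|X| = k -> chaos F X = chaos G X.
Hypothesis FS : forall A, ~~ (A \subset S) -> F A = 0.
Local Notation d := #|S|.
Hypothesis dk : (d <= k)%N.

(** The factor [n^d / n ^_ d], lost between slice and cube, is the one contained in the lower bound
    for [kappa], so only [2^d] remains. *)
Lemma low_levels_le :
  \sum_(B : {set T} | (4 * #|B| < 3 * d)%N) G B ^+ 2 <= 2 ^+ d * sqnorm F.
Proof.
have fX X : chaos F X = chaos F (X :&: S).
  apply: eq_bigr => A _; have [AS|/FS ->] := boolP (A \subset S); last by rewrite !mul0r.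
  congr (_ * _); apply: eq_bigr => i /(subsetP AS) iS.
  by rewrite /std_coord inE iS andbT.
have sn0 : s != 0 by rewrite gt_eqF.
have := @slice_avg_le_cube_avg R T k p S pn kn dk (fun X => chaos F X ^+ 2)
  (fun X => sqr_ge0 _) (fun X => congr1 (fun x => x ^+ 2) (fX X)).
rewrite (cube_avg_chaos_sq sn0 s2) (@eq_slice_avg _ _ _ _ (fun X => chaos G X ^+ 2)); last first.
  by move=> X /FG ->.
rewrite (slice_avg_harmonic_sq s0 s2 pn kn hG lG) => h.
have dn : (d <= n)%N := max_card _.
have nd : (0 : R) < (n ^ d)%:R by rewrite ltr0n expn_gt0 n0.
have nf : (0 : R) < (n ^_ d)%:R by rewrite ltr0n ffact_gt0.
rewrite -(ler_pM2l nd) [leRHS]mulrCA.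
apply: (@le_trans _ _ (2 ^+ d * ((\sum_(B : {set T}) kappa #|B| * G B ^+ 2) * (n ^_ d)%:R))); last first.
  by rewrite ler_wpM2l// exprn_ge0.
rewrite mulr_suml !mulr_sumr big_mkcond /=; apply: ler_sum => B _.
have [Bk|Bk] := leqP #|B| k; last first.
  by rewrite lG// expr0n !(mulr0, mul0r); case: ifP.
have kap := level_factor_gt0 s0 s2 pn kn Bk.
case: ifP => [Bd|_]; last first.
  by apply: mulr_ge0; rewrite ?exprn_ge0// mulr_ge0// mulr_ge0 ?sqr_ge0// ltW.
rewrite [leRHS](_ : _ = 2 ^+ d * kappa #|B| * (n ^_ d)%:R * G B ^+ 2); last by ring.
by rewrite ler_wpM2r ?sqr_ge0//; apply: level_factor_level_ge => //; apply: ltnW.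
Qed.

(** Cauchy-Schwarz with the weight [2 ^+ #|A :\: B|] gives [5^#|S :\: B|], at most [5^(d/4)] here,
    and summing over [B] then attaches [(5/4)^#|A|] to [F A ^+ 2]. Equal weights would give
    [2^(d/4) * 2^d] in this way. *)
Lemma umbral_coef_high_le :
  \sum_(B : {set T} | (3 * d <= 4 * #|B|)%N) umb F B ^+ 2 <= 2 ^+ d * sqnorm F.
Proof.
pose q := (d %/ 4)%N.
have t0 A B : 0 <= 5 ^+ q * (F A ^+ 2 * (4^-1) ^+ #|A :\: B|).
  by rewrite mulr_ge0 ?exprn_ge0// mulr_ge0 ?sqr_ge0// exprn_ge0// invr_ge0.
have h B : (3 * d <= 4 * #|B|)%N ->
  umb F B ^+ 2 <= \sum_(A : {set T} | B \subset A) 5 ^+ q * (F A ^+ 2 * (4^-1) ^+ #|A :\: B|).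
  move=> Bd; have [BS|BS] := boolP (B \subset S); last first.
    rewrite /umbral_coef big1 ?expr0n/= => [|A BA]; last first.
      by rewrite FS ?mul0r//; apply: contra BS; exact: subset_trans.
    by apply: sumr_ge0 => A _.
  have -> : umb F B = \sum_(A : {set T} | (B \subset A) && (A \subset S))
      (F A * (2^-1) ^+ #|A :\: B|) * (2 ^+ #|A :\: B| * w #|B| #|A :\: B|).
    rewrite /umbral_coef big_mkcondr; apply: eq_bigr => A BA.
    case: ifP => [_|/negbT/FS ->]; last by rewrite mul0r.
    by rewrite mulrA -(mulrA (F A)) -exprMn mulVf ?pnatr_eq0// expr1n mulr1.
  apply: (le_trans (cauchy_schwarz_sum _ _ _)).
  have E1 : \sum_(A : {set T} | (B \subset A) && (A \subset S))
      (2 ^+ #|A :\: B| * w #|B| #|A :\: B|) ^+ 2 <= 5 ^+ q.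
    apply: (@le_trans _ _ (\sum_(A : {set T} | (B \subset A) && (A \subset S)) 4 ^+ #|A :\: B|)).
      apply: ler_sum => A /andP[BA AS].
      rewrite (exprMn _ (2 ^+ _)) -exprM mulnC exprM (_ : 2 ^+ 2 = 4); last by ring.
      rewrite -[leRHS]mulr1 ler_wpM2l ?exprn_ge0// -real_normK ?num_real// expr_le1//.
      apply: (psi_ratio_le1 p0 p2 s0 s2 pn kn); rewrite cardsDS// subnKC ?subset_leq_card//.
      by apply: leq_trans dk; exact: subset_leq_card.
    rewrite sum_superset_exp// (_ : 1 + 4 = 5 :> R); last by ring.
    apply: ler_weXn2l; first by rewrite ler1n.
    have := subset_leq_card BS; rewrite cardsDS// /q; move: Bd; clear; lia.
  have P0 : 0 <= \sum_(A : {set T} | (B \subset A) && (A \subset S)) (F A * 2^-1 ^+ #|A :\: B|) ^+ 2.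
    by apply: sumr_ge0 => A _; exact: sqr_ge0.
  apply: (le_trans (ler_wpM2l P0 E1)); rewrite -mulr_sumr mulrC ler_wpM2l ?exprn_ge0//.
  rewrite big_mkcondr; apply: ler_sum => A BA; case: ifP => _; last first.
    by rewrite mulr_ge0 ?sqr_ge0// exprn_ge0// invr_ge0.
  by rewrite exprMn -exprM mulnC exprM (_ : 2^-1 ^+ 2 = 4^-1 :> R)//; field.
apply: (le_trans (ler_sum _ h)).
apply: (@le_trans _ _ (\sum_(B : {set T}) \sum_(A : {set T} | B \subset A)
    5 ^+ q * (F A ^+ 2 * (4^-1) ^+ #|A :\: B|))).
  rewrite big_mkcond; apply: ler_sum => B _; case: ifP => // _.
  by apply: sumr_ge0 => A _.
rewrite (exchange_big_dep predT)//= /sqnorm mulr_sumr; apply: ler_sum => A _.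
rewrite -!mulr_sumr sum_subset_exp.
have [AS|/FS ->] := boolP (A \subset S); last by rewrite expr0n mul0r !mulr0.
rewrite mulrCA mulrC ler_wpM2r ?sqr_ge0//.
apply: (@le_trans _ _ (5 ^+ q * (1 + 4^-1) ^+ d)).
  by rewrite ler_wpM2l ?exprn_ge0// ler_weXn2l ?subset_leq_card// lerDl invr_ge0.
rewrite (_ : 1 + 4^-1 = 5 / 4 :> R); last by field.
rewrite exprMn exprVn mulrA ler_pdivrMr ?exprn_gt0// -exprMn -natrM -!natrX -natrM ler_nat.
by apply: exp5_le; rewrite /q mulnC leq_trunc_div.
Qed.

(** The truncation of [G] to its high levels is harmonic. Testing against it shows that [G] and
    [umb F - G] are orthogonal on these levels, so [G] is no larger than [umb F] there. *)
Lemma high_levels_le :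
  \sum_(B : {set T} | (3 * d <= 4 * #|B|)%N) G B ^+ 2 <= 2 ^+ d * sqnorm F.
Proof.
pose c j : R := (3 * d <= 4 * j)%N%:R.
have hH := harmonic_coef_weight c hG.
have lH : coef_deg_le k (fun B => c #|B| * G B) by move=> B /lG ->; rewrite mulr0.
have := umbral_coef_orthogonal s0 s2 pn kn hG FG hH lH.
rewrite (eq_bigr (fun B => if (3 * d <= 4 * #|B|)%N then G B * umb F B - G B ^+ 2 else 0)); last first.
  by move=> B _; rewrite /c; case: ifP => _; rewrite ?mul0r// mul1r mulrBr expr2.
rewrite -big_mkcond sumrB => /eqP; rewrite subr_eq0 => /eqP E.
apply: le_trans umbral_coef_high_le.
have : 2 * \sum_(B : {set T} | (3 * d <= 4 * #|B|)%N) G B * umb F B <=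
    \sum_(B : {set T} | (3 * d <= 4 * #|B|)%N) G B ^+ 2 +
    \sum_(B : {set T} | (3 * d <= 4 * #|B|)%N) umb F B ^+ 2.
  rewrite mulr_sumr -big_split; apply: ler_sum => B _ /=.
  by have := sqr_ge0 (G B - umb F B); rewrite sqrrB; lra.
by rewrite E; lra.
Qed.

Lemma sqnorm_representative_le : sqnorm G <= 2 * 2 ^+ d * sqnorm F.
Proof.
rewrite /sqnorm (bigID (fun B => (3 * d <= 4 * #|B|)%N)) /=.
have := high_levels_le; have := low_levels_le; rewrite /sqnorm => h1 h2.
rewrite [X in _ + X](eq_bigl (fun B : {set T} => (4 * #|B| < 3 * d)%N)); last first.
  by move=> B; rewrite ltnNge.
move: h1 h2; lra.
Qed.

Lemma dist_harmonic_representative :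
  sqnorm (fun B => F B - G B) <=
  80 * ((d ^ 2 * 2 ^ d)%:R / (p * (1 - p) * n%:R)) * sqnorm F.
Proof.
rewrite -s2 natrM !natrX.
have sn : 0 < s ^+ 2 * n%:R by rewrite mulr_gt0 ?exprn_gt0.
have [d2n|d2n] := leP ((4 * d ^ 2)%:R) (s ^+ 2 * n%:R).
  apply: (le_trans (dist_small_degree p0 p2 s0 s2 pn kn n0 hG lG FG FS dk d2n)).
  rewrite ler_wpM2r ?sqnorm_ge0// ler_wpM2l// -mulrA mulrCA ler_wpM2l ?sqr_ge0//.
  rewrite ler_wpM2l ?exprn_ge0// lef_pV2 ?posrE// ler_piMl// s2.
  by move: p0 p2; nra.
(* Now [4 d^2 / (s^2 n) > 1], so a multiple [20 * 2^d] of [sqnorm F] is allowed, while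
   [2 * sqnorm F + 2 * sqnorm G] needs only [6 * 2^d]. *)
have E := sqnormD_le F (fun B => - G B).
have E' : sqnorm (fun B => - G B) = sqnorm G by apply: eq_bigr => B _; rewrite sqrrN.
have Gle := sqnorm_representative_le.
have F0 := sqnorm_ge0 F.
have d1 : (1 : R) <= 2 ^+ d by rewrite exprn_ege1// ler1n.
have K1 : 1 <= 4 * (d%:R ^+ 2 / (s ^+ 2 * n%:R)).
  by rewrite mulrA ler_pdivlMr// mul1r -natrX -natrM ltW.
have h1 : sqnorm F <= 2 ^+ d * sqnorm F by rewrite ler_peMl.
have h2 : 2 ^+ d * sqnorm F <= 4 * (d%:R ^+ 2 / (s ^+ 2 * n%:R)) * (2 ^+ d * sqnorm F).
  by rewrite ler_peMl// mulr_ge0// exprn_ge0.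
rewrite [leRHS](_ : _ = 20 * (4 * (d%:R ^+ 2 / (s ^+ 2 * n%:R)) * (2 ^+ d * sqnorm F))); last by ring.
move: E Gle h1 h2; rewrite E'; set a := 4 * _ * _.
have := mulr_ge0 (exprn_ge0 d (ler0n R 2)) F0; lra.
Qed.

End Distance.

(** * Coefficients of multilinear polynomials *)

Section Coefficients.
Context {R : realFieldType} {n : nat}.
Implicit Types (f g : mpoly.mpoly n R) (A B : {set 'I_n}) (m : multinom n).

Definition set_multinom A : multinom n := Multinom [tuple nat_of_bool (i \in A) | i < n].

Lemma set_multinomE A i : set_multinom A i = (i \in A).
Proof. exact: mnmE. Qed.

Definition set_coeff f A : R := mcoeff (set_multinom A) f.

Variable f : mpoly.mpoly n R.
Hypothesis ml_f : forall i : 'I_n, mderiv i (mderiv i f) = 0.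

(** Differentiating twice multiplies the coefficient of [m] by [m i * (m i - 1)], nonzero when [m i]
    is at least [2]. *)
Lemma multilinear_exponent m i : m \in msupp f -> (m i <= 1)%N.
Proof.
rewrite leqNgt => mf; apply/negP => mi; move: mf; apply/negP.
rewrite -mcoeff_eq0; have /(congr1 (mcoeff (mnm_sub (mnm_sub m (mnm1 i)) (mnm1 i)))) := ml_f i.
rewrite mcoeff0 !mcoeff_deriv => /eqP; rewrite -mulrnA mulrn_eq0 muln_eq0 /=.
congr (mcoeff _ f == 0); apply/mnmP => j; rewrite !mnmDE !mnmBE !mnm1E.
by case: eqVneq => [<-|_] /=; lia.
Qed.

Lemma multilinear_multinom m : m \in msupp f ->
  m = set_multinom [set i | m i != 0%N].
Proof.
move=> mf; apply/mnmP => i; rewrite set_multinomE inE.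
by have := multilinear_exponent i mf; case: (m i) => [|[|]].
Qed.

Lemma set_multinomK : cancel set_multinom (fun m => [set i | m i != 0%N]).
Proof. by move=> A; apply/setP => i; rewrite inE set_multinomE; case: (i \in A). Qed.

Lemma meval_multilinear (v : 'I_n -> R) :
  meval v f = \sum_(A : {set 'I_n}) set_coeff f A * \prod_(i in A) v i.
Proof.
rewrite mevalE; pose phi m := mcoeff m f * \prod_i v i ^+ m i.
have phiE A : phi (set_multinom A) = set_coeff f A * \prod_(i in A) v i.
  congr (_ * _); rewrite [RHS]big_mkcond; apply: eq_bigr => i _.
  by rewrite set_multinomE; case: ifP.
pose supp m : {set 'I_n} := [set i | m i != 0%N].
rewrite -[LHS]/(\sum_(m <- msupp f) phi m) (partition_big supp predT)//=.
apply: eq_bigr => A _; rewrite -phiE.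
have [Af|Af] := boolP (set_multinom A \in msupp f).
  rewrite big_mkcond (bigD1_seq (set_multinom A))//= /supp set_multinomK eqxx.
  rewrite big_seq_cond big1 ?addr0// => m /andP[mf mA]; case: eqP => // E.
  by move: mA; rewrite -E -multilinear_multinom ?eqxx.
rewrite big_seq_cond big1 => [|m /andP[mf /eqP mA]]; last first.
  by move: Af; rewrite -mA /supp -multilinear_multinom ?mf.
by rewrite /phi memN_msupp_eq0 ?mul0r.
Qed.

Variables (p s : R).
Hypothesis s0 : s != 0.

(** The result of substituting [x_i = p + s * om_i] and expanding. *)
Definition chaos_coeff B :=
  s ^+ #|B| * \sum_(A : {set 'I_n} | B \subset A) set_coeff f A * p ^+ #|A :\: B|.

Lemma meval_chaos (v : 'I_n -> R) :
  meval v f = \sum_(B : {set 'I_n}) chaos_coeff B * \prod_(i in B) ((v i - p) / s).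
Proof.
rewrite meval_multilinear.
transitivity (\sum_(A : {set 'I_n}) \sum_(B : {set 'I_n} | B \subset A)
   set_coeff f A * ((\prod_(i in B) (v i - p)) * p ^+ #|A :\: B|)).
  apply: eq_bigr => A _; rewrite -mulr_sumr; congr (_ * _).
  under eq_bigr => i _ do rewrite -(subrK p (v i)).
  by rewrite prod_subsetD; apply: eq_bigr => B _; rewrite prodr_const.
rewrite (exchange_big_dep predT)//=; apply: eq_bigr => B _.
rewrite /chaos_coeff big_split /= prodr_const mulr_sumr mulr_suml.
apply: eq_bigr => A _; rewrite exprVn; field.
by rewrite expf_neq0.
Qed.

Lemma set_coeff_occurring A : set_coeff f A != 0 ->
  A \subset [set i | has (fun m => m i != 0%N) (msupp f)].
Proof.
rewrite /set_coeff -mcoeff_msupp => Af; apply/subsetP => i iA; rewrite inE.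
by apply/hasP; exists (set_multinom A); rewrite // set_multinomE iA.
Qed.

Lemma chaos_coeff_occurring B :
  ~~ (B \subset [set i | has (fun m => m i != 0%N) (msupp f)]) -> chaos_coeff B = 0.
Proof.
move=> Bf; rewrite /chaos_coeff big1 ?mulr0// => A BA.
have [->|/set_coeff_occurring Af] := eqVneq (set_coeff f A) 0; first by rewrite mul0r.
by rewrite (subset_trans BA Af) in Bf.
Qed.

Lemma mdeg_set_multinom A : mdeg (set_multinom A) = #|A|.
Proof.
by rewrite mdegE -sum1_card [RHS]big_mkcond; apply: eq_bigr => i _; rewrite set_multinomE.
Qed.

Lemma chaos_coeff_msize k B : (mpoly.msize f <= k.+1)%N -> (k < #|B|)%N -> chaos_coeff B = 0.
Proof.
move=> fk kB; rewrite /chaos_coeff big1 ?mulr0// => A /subset_leq_card BA.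
rewrite /set_coeff memN_msupp_eq0 ?mul0r//; apply: msize_mdeg_ge.
by rewrite mdeg_set_multinom (leq_trans fk)// (leq_trans kB).
Qed.

Lemma harmonic_set_coeff : \sum_(i < n) mderiv i f = 0 -> harmonic_coef (set_coeff f).
Proof.
move=> hf U; have := congr1 (mcoeff (set_multinom U)) hf.
rewrite mcoeff0 raddf_sum /= => E; rewrite -[RHS]E [RHS](bigID (mem U)) /= [X in _ = X + _]big1 ?add0r.
  apply: eq_bigr => i iU; rewrite mcoeff_deriv set_multinomE (negbTE iU) mulr1n.
  congr (mcoeff _ f); apply/mnmP => j; rewrite mnmDE !set_multinomE mnm1E !inE.
  by case: (eqVneq j i) => [->|_]; rewrite ?(negbTE iU) ?addn0.
move=> i iU; rewrite mcoeff_deriv memN_msupp_eq0 ?mul0rn//.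
apply/negP => /(multilinear_exponent i); rewrite mnmDE set_multinomE mnm1E eqxx iU.
by [].
Qed.

(** For harmonic [f] the superset sum collapses, that is, the shift by [p] has no effect; only the
    rescaling of levels by [s ^+ #|B|] remains. *)
Lemma harmonic_chaos_coeff : \sum_(i < n) mderiv i f = 0 -> harmonic_coef chaos_coeff.
Proof.
move=> /harmonic_set_coeff hf.
have E B : chaos_coeff B = s ^+ #|B| * set_coeff f B.
  congr (_ * _).
  have := @harmonic_coef_superset_sum R _ R^o _ (fun j => p ^+ j) B hf.
  by rewrite /GRing.scale /= expr0 mulr1.
move=> U; under eq_bigr do rewrite E.
exact: (harmonic_coef_weight (fun j => s ^+ j) hf).
Qed.

End Coefficients.

From mathcomp Require Import all_classical all_reals all_analysis.
From mathcomp Require Import measurable_realfun.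
Import numFieldNormedType.Exports.
Local Open Scope classical_set_scope.

(** * Moments of the normal distribution *)

Section NormalDensity.
Context {R : realType}.
Local Notation mu := (@lebesgue_measure R).

Lemma ge0_integral_normal_prob (m s : R) (f : measurableTypeR R -> \bar R) :
  measurable_fun setT f -> (forall x, 0 <= f x)%E ->
  (\int[normal_prob m s]_x f x = \int[mu]_x (f x * (normal_pdf m s x)%:E))%E.
Proof.
move=> mf f0.
rewrite -(Radon_Nikodym_SigmaFinite.change_of_variables (normal_prob_dominates m s))//.
have fi := Radon_Nikodym_SigmaFinite.f_integrable (normal_prob_dominates m s).
apply: ae_eq_integral => //.
- by apply: emeasurable_funM => //; exact: measurable_int fi.
- apply: emeasurable_funM => //; apply/measurable_EFinP; exact: measurable_normal_pdf.
- apply: ae_eqe_mul2l; apply: integral_ae_eq => //.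
  + by apply/measurable_EFinP; exact: measurable_normal_pdf.
  + move=> E _ mE; by rewrite -Radon_Nikodym_SigmaFinite.f_integral//; exact: normal_prob_dominates.
Qed.

End NormalDensity.

Section HalfGaussMoment.
Context {R : realType}.
Local Notation mu := (@lebesgue_measure R).

Lemma is_derive_gauss_fun (x : R) : is_derive x 1 (@gauss_fun R) (- (2 * x) * gauss_fun x).
Proof.
rewrite /gauss_fun; apply: is_derive_eq.
by rewrite /GRing.scale /= mulr1; ring.
Qed.

Lemma cvg_id_gauss_fun : (x * gauss_fun x : R) @[x --> +oo%R] --> (0 : R).
Proof.
apply: (@squeeze_cvgr _ _ _ _ (fun=> 0) (fun x => x^-1)); last 2 first.
- exact: cvg_cst.
- apply/gtr0_cvgV0; [exact: nbhs_pinfty_gt|exact: cvg_id].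
near=> x.
have x0 : 0 < x by near: x; apply: nbhs_pinfty_gt; exact: num_real.
rewrite mulr_ge0 ?gauss_fun_ge0 ?(ltW x0)//= /gauss_fun expRN.
rewrite ler_pdivrMr ?expR_gt0// mulrC ler_pdivlMr// -expr2.
by apply: le_trans (expR_ge1Dx _); rewrite lerDr.
Unshelve. all: by end_near. Qed.

(* The derivative [(2 x^2 - 1) gauss_fun x] of [- x gauss_fun x] changes sign, while the
   improper fundamental theorem wants a nonnegative integrand: adding [f] makes it so. *)
Let F (x : R) : R := - (4 * (1 + x)^-1).
Let f (x : R) : R := 4 * (1 + x) ^- 2.
Let G (x : R) : R := F x - x * gauss_fun x.
Let g (x : R) : R := f x + (2 * x ^+ 2 - 1) * gauss_fun x.

Let dF (x : R) : 0 <= x -> is_derive x 1 F (f x).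
Proof.
move=> x0; have x1 : 1 + x != 0 by rewrite gt_eqF// ltr_pwDl.
rewrite /F /f; apply: is_derive_eq.
by rewrite /GRing.scale /=; field.
Qed.

Let dG (x : R) : 0 <= x -> is_derive x 1 G (g x).
Proof.
move=> x0; have h := dF x0.
have h' := is_derive_gauss_fun x.
rewrite /G /g; apply: is_derive_eq.
rewrite /GRing.scale /=; ring.
Qed.

Lemma is_derive_continuous (h : R -> R) (x a : R) : is_derive x 1 h a -> {for x, continuous h}.
Proof. by move=> [dh _]; apply/differentiable_continuous/derivable1_diffP. Qed.

Let cf (x : R) : 0 <= x -> {for x, continuous f}.
Proof.
move=> x0; have x1 : 1 + x != 0 by rewrite gt_eqF// ltr_pwDl.
have x2 : (1 + x) ^+ 2 != 0 by rewrite expf_neq0.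
by rewrite /f; apply: is_derive_continuous.
Qed.

Let cg (x : R) : 0 <= x -> {for x, continuous g}.
Proof.
move=> x0; apply: continuousD; first exact: cf.
by apply: continuousM; [apply: is_derive_continuous|exact: continuous_gauss_fun].
Qed.

Let cF : F x @[x --> +oo%R] --> (0 : R).
Proof.
have h : (1 + x : R)^-1 @[x --> +oo%R] --> (0 : R).
  apply/gtr0_cvgV0; last exact: cvg_addrl.
  by near=> x; rewrite addr_gt0//; near: x; apply: nbhs_pinfty_gt; exact: num_real.
have := cvgN (cvgM (@cvg_cst _ (4 : R) _ (+oo%R : set_system R) _) h); rewrite mulr0 oppr0; exact.
Unshelve. all: by end_near. Qed.

Let cG : G x @[x --> +oo%R] --> (0 : R).
Proof. by rewrite -(subr0 0); apply: cvgB; [exact: cF|exact: cvg_id_gauss_fun]. Qed.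

Let f0 (x : R) : 0 <= x -> 0 <= f x.
Proof. by move=> x0; rewrite mulr_ge0// invr_ge0 exprn_ge0// addr_ge0. Qed.

(** The [4] in [f] makes [f x >= 1] on [[0, 1]], the only region where [2 * x ^+ 2 - 1], never below
    [-1], can be negative. *)
Let g0 (x : R) : 0 <= x -> 0 <= g x.
Proof.
move=> x0; rewrite /g; have [x2|x2] := leP 1 (2 * x ^+ 2).
  by rewrite addr_ge0 ?f0// mulr_ge0 ?gauss_fun_ge0// subr_ge0.
have f1 : 1 <= f x.
  rewrite /f ler_pdivlMr ?exprn_gt0 ?ltr_pwDl// mul1r.
  have x1 : x <= 1 by rewrite leNgt; apply/negP => x1; move: x2; nra.
  nra.
have := gauss_fun_le1 x; have := gauss_fun_ge0 x; have := sqr_ge0 x; nra.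
Qed.

Let ftc (h H : R -> R) : (forall x : R, 0 <= x -> 0 <= h x) ->
  (forall x : R, 0 <= x -> {for x, continuous h}) ->
  (forall x : R, 0 <= x -> is_derive x 1 H (h x)) ->
  H x @[x --> +oo%R] --> (0 : R) -> H 0 = - 4 ->
  (\int[mu]_(x in `[0%R, +oo[) (h x)%:E = 4%:E)%E.
Proof.
move=> h0 ch dH cH H0; rewrite (@ge0_continuous_FTC2y _ h H 0 0)//.
- by rewrite H0 -EFinB sub0r opprK.
- by apply: continuous_in_subspaceT => x; rewrite inE /= in_itv /= andbT; exact: ch.
- by move=> x /ltW /dH [].
- by apply: cvg_at_right_filter; exact: (is_derive_continuous (dH 0 (lexx 0))).
- by move=> x; rewrite in_itv /= andbT => /ltW /dH h'; rewrite derive1E derive_val.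
Qed.

Lemma integral0y_sqr_gauss :
  (\int[mu]_(x in `[0%R, +oo[) (x ^+ 2 * gauss_fun x)%:E = (Num.sqrt pi / 4)%:E)%E.
Proof.
have If : (\int[mu]_(x in `[0%R, +oo[) (f x)%:E = 4%:E)%E.
  by apply: (ftc f0 cf dF cF); rewrite /F addr0 invr1 mulr1.
have Ig : (\int[mu]_(x in `[0%R, +oo[) (g x)%:E = 4%:E)%E.
  by apply: (ftc g0 cg dG cG); rewrite /G mul0r subr0 /F addr0 invr1 mulr1.
have mgauss := @measurable_gauss_fun R.
have mf : measurable_fun (`[(0:R), +oo[%classic : set R) f.
  apply: subspace_continuous_measurable_fun => //.
  by apply: continuous_in_subspaceT => x; rewrite inE /= in_itv /= andbT; exact: cf.
have mg : measurable_fun (`[(0:R), +oo[%classic : set R) g.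
  apply: subspace_continuous_measurable_fun => //.
  by apply: continuous_in_subspaceT => x; rewrite inE /= in_itv /= andbT; exact: cg.
have mG : measurable_fun (`[(0:R), +oo[%classic : set R) (@gauss_fun R) by exact: measurable_funTS.
have mq : measurable_fun (`[(0:R), +oo[%classic : set R) (fun x : R => x ^+ 2 * gauss_fun x).
  by apply: measurable_funM => //; apply: measurable_funTS; exact: exprn_measurable.
(* Both sides are sums of nonnegative functions, so they split before finiteness is known. As [f]
   and [g] have equal finite integrals, the second moment is half the integral of [gauss_fun]. *)
have E : (\int[mu]_(x in `[0%R, +oo[) (g x + gauss_fun x)%:E =
          \int[mu]_(x in `[0%R, +oo[) (f x + 2 * (x ^+ 2 * gauss_fun x))%:E)%E.
  by apply: eq_integral => x _; congr EFin; rewrite /g; ring.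
move: E; under eq_integral do rewrite EFinD.
rewrite ge0_integralD//=; last first.
- exact/measurable_EFinP.
- by move=> x _; rewrite lee_fin gauss_fun_ge0.
- exact/measurable_EFinP.
- by move=> x; rewrite in_itv /= andbT lee_fin; exact: g0.
under [in RHS]eq_integral do rewrite EFinD.
rewrite ge0_integralD//=; last first.
- by apply/measurable_EFinP; apply: measurable_funM.
- by move=> x _; rewrite lee_fin mulr_ge0// mulr_ge0 ?sqr_ge0 ?gauss_fun_ge0.
- exact/measurable_EFinP.
- by move=> x; rewrite in_itv /= andbT lee_fin; exact: f0.
under [X in (_ = _ + X)%E]eq_integral do rewrite EFinM.
rewrite ge0_integralZl//=; last 2 first.
- exact/measurable_EFinP.
- by move=> x _; rewrite lee_fin mulr_ge0 ?sqr_ge0 ?gauss_fun_ge0.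
rewrite If Ig integral0y_gauss.
case: (integral _ _ _) => [r| |] //=.
- by rewrite -EFinM -!EFinD => -[E]; congr EFin; lra.
- by rewrite mulry gtr0_sg// mul1e.
- by rewrite mulrNy gtr0_sg// mul1e.
Qed.

End HalfGaussMoment.

Section NormalMoments.
Context {R : realType}.
Local Notation mu := (@lebesgue_measure R).

Lemma ge0_integralT_half (f : R -> R) : (forall x, 0 <= f x) -> continuous f ->
  (\int[mu]_x (f x)%:E = \int[mu]_(x in `[0%R, +oo[) (f x)%:E +
                         \int[mu]_(x in `[0%R, +oo[) (f (- x)%R)%:E)%E.
Proof.
move=> f0 cf.
have mf : measurable_fun [set: R] f by exact: continuous_measurable_fun.
rewrite -(setUv (`[0%R, +oo[%classic : set R)) ge0_integral_setU//= ; last 4 first.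
  exact: measurableC.
  by apply/measurable_EFinP; rewrite setUv.
  by move=> x _; rewrite lee_fin.
  exact/disj_setPCl.
congr (_ + _)%E; rewrite setCitvr integral_itv_bndo_bndc; last exact/measurable_EFinP/measurable_funTS.
by rewrite -{1}oppr0 ge0_integration_by_substitutionNy//; exact: continuous_subspaceT.
Qed.

Lemma ge0_integralT_opp (f : R -> R) : (forall x, 0 <= f x) -> continuous f ->
  (\int[mu]_x (f (- x)%R)%:E = \int[mu]_x (f x)%:E)%E.
Proof.
move=> f0 cf; rewrite [RHS]ge0_integralT_half// [LHS]ge0_integralT_half//; last first.
  by move=> x; apply: continuous_comp; [exact: opp_continuous|exact: cf].
by rewrite addeC; congr (_ + _)%E; apply: eq_integral => x _; rewrite opprK.
Qed.

Lemma integralT_sqr_gauss :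
  (\int[mu]_x (x ^+ 2 * gauss_fun x)%:E = (Num.sqrt pi / 2)%:E)%E.
Proof.
rewrite ge0_integralT_half; last 2 first.
- by move=> x; rewrite mulr_ge0 ?sqr_ge0 ?gauss_fun_ge0.
- by move=> x; apply: cvgM; [exact: exprn_continuous|exact: continuous_gauss_fun].
rewrite integral0y_sqr_gauss.
under eq_integral do rewrite /gauss_fun !sqrrN.
by rewrite integral0y_sqr_gauss -EFinD; congr EFin; field.
Qed.

Variables (m s : R).
Hypothesis s0 : 0 < s.
Local Notation N := (normal_prob m s).
(** The exponent of [gauss_fun] is [- x ^+ 2], without the factor [1 / 2], whence [Num.sqrt 2]. *)
Let u : R := s * Num.sqrt 2.

Let u0 : 0 < u. Proof. by rewrite mulr_gt0 ?sqrtr_gt0. Qed.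

Let F (x : R) : R := (x - m) / u.

Let normal_pdf_gauss x : normal_pdf m s x = (u * Num.sqrt pi)^-1 * gauss_fun (F x).
Proof.
rewrite normal_pdfE ?gt_eqF//; congr (_ * _).
  rewrite /normal_peak /u -mulr_natr -mulrA sqrtrM ?sqr_ge0// sqrtr_sqr gtr0_norm//.
  by rewrite mulrC -mulrA; congr (_^-1); rewrite sqrtrM ?pi_ge0// mulrC [in LHS](mulrC (Num.sqrt pi)).
rewrite /normal_fun /gauss_fun; congr expR; rewrite /F exprMn exprVn mulNr /u exprMn sqr_sqrtr//.
by rewrite mulr_natr.
Qed.

Lemma ge0_integral_normal_gauss (G : R -> R) : (forall x, 0 <= G x) -> continuous G ->
  (\int[N]_x (G (F x))%:E = (Num.sqrt pi)^-1%:E * \int[mu]_x (G x * gauss_fun x)%:E)%E.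
Proof.
move=> G0 cG.
have mG : measurable_fun [set: R] G by exact: continuous_measurable_fun.
have mF : measurable_fun [set: R] F.
  by apply: measurable_funM => //; apply: measurable_funB.
rewrite ge0_integral_normal_prob; last 2 first.
- by apply/measurable_EFinP; exact: measurableT_comp.
- by move=> x; rewrite lee_fin.
have dF (x : R) : is_derive x 1 F u^-1.
  by rewrite /F; apply: is_derive_eq; rewrite /GRing.scale /=; ring.
have F' : F^`()%classic = cst u^-1 by apply/funext => x; rewrite derive1E derive_val.
rewrite (@increasing_ge0_integration_by_substitutionT _ F (fun x => G x * gauss_fun x)).
- rewrite -ge0_integralZl//=; last 2 first.
  + apply/measurable_EFinP; rewrite F'; apply: measurable_funM => //.
    by apply: measurable_funM; apply: measurableT_comp => //; exact: measurable_gauss_fun.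
  + by move=> x _; rewrite lee_fin F' mulr_ge0 ?invr_ge0 ?(ltW u0)//= mulr_ge0 ?gauss_fun_ge0.
  apply: eq_integral => x _; rewrite normal_pdf_gauss -!EFinM; congr EFin.
  by rewrite F' fctE invfM /=; ring.
- by move=> x y xy; rewrite /F ltr_pM2r ?invr_gt0// ltrD2r.
- by rewrite F' => x; exact: cvg_cst.
- by rewrite F'; exact: is_cvg_cst.
- by rewrite F'; exact: is_cvg_cst.
- by move=> x; case: (dF x).
- by apply/gt0_cvgMlNy; [rewrite invr_gt0|exact: cvg_addrr_Ny].
- by apply/gt0_cvgMly; [rewrite invr_gt0|exact: cvg_addrr].
- by move=> x; apply: cvgM; [exact: cG|exact: continuous_gauss_fun].
- by move=> x; rewrite mulr_ge0 ?gauss_fun_ge0.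
Qed.

Local Notation h := (fun x : R => (x - m) / s).

Let hF x : h x = Num.sqrt 2 * F x.
Proof. by rewrite /F /u; field; rewrite gt_eqF//= gt_eqF// sqrtr_gt0. Qed.

Lemma normal_second_moment : (\int[N]_x (((x - m) / s) ^+ 2)%:E = 1%:E)%E.
Proof.
under eq_integral => x _ do rewrite hF.
rewrite (ge0_integral_normal_gauss (G := fun y => (Num.sqrt 2 * y) ^+ 2)); last 2 first.
- by move=> x; rewrite sqr_ge0.
- by move=> x; apply: is_derive_continuous.
under eq_integral do rewrite exprMn sqr_sqrtr// -mulrA EFinM.
rewrite ge0_integralZl//=; last 2 first.
- apply/measurable_EFinP; apply: measurable_funM; first exact: exprn_measurable.
  exact: measurable_gauss_fun.
- by move=> x _; rewrite lee_fin mulr_ge0 ?sqr_ge0 ?gauss_fun_ge0.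
rewrite integralT_sqr_gauss -!EFinM; congr EFin; field.
by rewrite gt_eqF// sqrtr_gt0 pi_gt0.
Qed.

Lemma measurable_standardize : measurable_fun setT h.
Proof. by apply: measurable_funM => //; apply: measurable_funB. Qed.

Lemma normal_first_moment : (\int[N]_x ((x - m) / s)%:E = 0)%E.
Proof.
(* [G (+- sqrt 2)] is nonnegative, so that it can be reflected before integrability
   of [h] is known. *)
pose G (c y : R) : R := 1 + c * y + 2 * y ^+ 2.
have G0 c y : c ^+ 2 = 2 -> 0 <= G c y.
  move=> c2; rewrite /G; have := sqr_ge0 (c * y / 2 + 1); rewrite sqrrD !exprMn c2.
  by have := sqr_ge0 y; lra.
have cG c : continuous (G c) by move=> x; apply: is_derive_continuous.
have r2 : Num.sqrt 2 ^+ 2 = 2 :> R by rewrite sqr_sqrtr.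
have r2' : (- Num.sqrt 2) ^+ 2 = 2 :> R by rewrite sqrrN.
have E : (\int[N]_x (G (Num.sqrt 2) (F x))%:E = \int[N]_x (G (- Num.sqrt 2) (F x))%:E)%E.
  rewrite !ge0_integral_normal_gauss//; try by move=> y; exact: G0.
  congr (_ * _)%E.
  rewrite -(@ge0_integralT_opp (fun x => G (- Num.sqrt 2) x * gauss_fun x)).
  - by apply: eq_integral => x _; rewrite /G /gauss_fun !sqrrN mulrNN.
  - by move=> x; rewrite mulr_ge0 ?gauss_fun_ge0 ?G0.
  - by move=> x; apply: cvgM; [exact: cG|exact: continuous_gauss_fun].
have mh := measurable_standardize.
have ih2 : N.-integrable setT (fun x => (h x ^+ 2)%:E).
  apply/integrableP; split; first by apply/measurable_EFinP; apply: measurable_funX.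
  under eq_integral => x _ do rewrite gee0_abs ?lee_fin ?sqr_ge0//.
  by rewrite normal_second_moment ltry.
have i1 : N.-integrable setT (fun x => (1 + h x ^+ 2)%:E).
  have i1 : N.-integrable setT (EFin \o cst (1 : R)) by exact: finite_measure_integrable_cst.
  by have := integrableD measurableT i1 ih2; apply: eq_integrable => // x _; rewrite EFinD.
have ih : N.-integrable setT (fun x => (h x)%:E).
  apply: le_integrable i1 => //; first exact/measurable_EFinP.
  move=> x _ /=; rewrite lee_fin (ger0_norm (_ : 0 <= 1 + _ ^+ 2)) ?addr_ge0 ?sqr_ge0//.
  set y := (x - m) / s; have := sqr_ge0 (y + 1); have := sqr_ge0 (y - 1).
  by have := sqr_ge0 y; rewrite ler_norml sqrrB sqrrD; lra.
(* [G (+- sqrt 2) (F x)] is [1 + h x ^+ 2 +- h x], so the equality of the two integrals forces that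
   of [h] to vanish. *)
have E1 : (\int[N]_x (G (Num.sqrt 2) (F x))%:E =
    \int[N]_x ((1 + h x ^+ 2)%:E + (h x)%:E))%E.
  by apply: eq_integral => x _; rewrite -EFinD; congr EFin; rewrite !hF /G (exprMn _ (Num.sqrt 2)) r2; ring.
have E2 : (\int[N]_x (G (- Num.sqrt 2) (F x))%:E =
    \int[N]_x ((1 + h x ^+ 2)%:E - (h x)%:E))%E.
  by apply: eq_integral => x _; rewrite -EFinB; congr EFin; rewrite !hF /G (exprMn _ (Num.sqrt 2)) r2; ring.
move: E; rewrite E1 E2.
rewrite integralD// integralB//.
have /fineK <- := integrable_fin_num measurableT ih.
have /fineK <- := integrable_fin_num measurableT i1.
by rewrite -EFinD -EFinB => -[E']; congr EFin; lra.
Qed.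

End NormalMoments.

(** * Orthogonality under product measures *)

Section PowerProb.
Context {d : measure_display} {T : measurableType d} {R : realType}.
Variable P : probability T R.

(** Integrability and value go through one induction: Fubini along [tuple_cons] computes the
    integral once Tonelli has given integrability. *)
Lemma integrable_prod_power_prob n (u : 'I_n -> T -> R) (e : 'I_n -> R) :
  (forall i, P.-integrable setT (EFin \o u i)) ->
  (forall i, \int[P]_x (u i x)%:E = (e i)%:E)%E ->
  (power_prob P n).-integrable setT (fun x => (\prod_i u i (tnth x i))%:E) /\
  (\int[power_prob P n]_x (\prod_i u i (tnth x i))%:E = (\prod_i e i)%:E)%E.
Proof.
elim: n u e => [|n IH] u e iu ue.
  split.
    under [X in _.-integrable _ X]funext do rewrite big_ord0.
    exact: finite_measure_integrable_cst.
  under eq_integral do rewrite big_ord0.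
  by rewrite big_ord0 integral_cst//= diracE mem_set// mule1.
have [ig Eg] := IH (fun i => u (lift ord0 i)) (fun i => e (lift ord0 i))
  (fun i => iu _) (fun i => ue _).
set g := fun x => _ in ig; set c := \prod_i _ in Eg.
pose G (y : n.+1.-tuple T) : R := \prod_i u i (tnth y i).
have mu i : measurable_fun setT (u i).
  by apply/measurable_EFinP; exact: measurable_int (iu i).
have mG : measurable_fun setT (EFin \o G).
  apply/measurable_EFinP; apply: measurable_prod => i _.
  by apply: measurableT_comp => //; exact: measurable_tnth.
have GE a x : G (tuple_cons (a, x)) = u ord0 a * \prod_i u (lift ord0 i) (tnth x i).
  rewrite /G big_ord_recl; congr (_ * _).
  by apply: eq_bigr => i _; rewrite tnthS.
have mc : measurable_fun setT ((EFin \o G) \o @tuple_cons _ T n).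
  by apply: measurableT_comp => //; exact: measurable_tuple_cons.
have iabs : (\int[power_prob P n]_x `|g x| < +oo)%E.
  by case/integrableP: ig.
have mg : measurable_fun setT g by case/integrableP: ig.
have iQ : (P \x power_prob P n)%E.-integrable setT ((EFin \o G) \o @tuple_cons _ T n).
  apply/integrable12ltyP => //.
  have E a : (\int[power_prob P n]_x `|((EFin \o G) \o @tuple_cons _ T n) (a, x)| =
      `|(u ord0 a)%:E| * \int[power_prob P n]_x `|g x|)%E.
    rewrite -ge0_integralZl//; last exact: measurableT_comp.
    by apply: eq_integral => x _; rewrite [in LHS]/comp GE EFinM abseM.
  under eq_integral => a _ do rewrite E.
  rewrite ge0_integralZr//; [|by apply: measurableT_comp => //; exact/measurable_EFinP|exact: integral_ge0].
  apply: lte_mul_pinfty; rewrite ?integral_ge0//.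
  by rewrite ge0_fin_numE ?integral_ge0//; case/integrableP: (iu ord0).
split.
  have := @integrable_pushforward _ _ _ _ R _ (@measurable_tuple_cons _ T n) (P \x power_prob P n)%E setT (EFin \o G) mG iQ measurableT.
  exact.
rewrite integral_distribution//.
rewrite -integral12_prod_meas1//.
rewrite (eq_integral (fun a => (u ord0 a)%:E * c%:E)%E); last first.
  move=> a _; rewrite /fubini_F -Eg -integralZl//.
  by apply: eq_integral => x _; rewrite /g -EFinM -GE.
rewrite integralZr//; last exact: iu.
by rewrite ue big_ord_recl EFinM.
Qed.

Lemma integral_power_prob_chaos_sq n (h : T -> R) (F : {set 'I_n} -> R) :
  measurable_fun setT h ->
  P.-integrable setT (EFin \o h) ->
  P.-integrable setT (fun x => (h x ^+ 2)%:E) ->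
  (\int[P]_x (h x)%:E = 0)%E -> (\int[P]_x (h x ^+ 2)%:E = 1%:E)%E ->
  (\int[power_prob P n]_x
     ((\sum_(A : {set 'I_n}) F A * \prod_(i in A) h (tnth x i)) ^+ 2)%:E = (sqnorm F)%:E)%E.
Proof.
move=> mh ih ih2 h0 h1.
pose v (A : {set 'I_n}) i y : R := if i \in A then h y else 1.
pose u (A B : {set 'I_n}) i y : R := v A i y * v B i y.
(* The mean of the factor [i]: the second moment or a constant when [A] and [B] agree at [i], the
   vanishing first moment otherwise. *)
pose e (A B : {set 'I_n}) i : R := ((i \in A) == (i \in B))%:R.
have i1 : P.-integrable setT (EFin \o cst (1 : R)) by exact: finite_measure_integrable_cst.
have iu A B i : P.-integrable setT (EFin \o u A B i).
  rewrite /u /v; case: (i \in A); case: (i \in B).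
  - by under eq_fun do rewrite -expr2.
  - by under eq_fun do rewrite mulr1.
  - by under eq_fun do rewrite mul1r.
  - by under eq_fun do rewrite mul1r.
have ue A B i : (\int[P]_x (u A B i x)%:E = (e A B i)%:E)%E.
  rewrite /u /v /e; case: (i \in A); case: (i \in B) => /=.
  - by under eq_integral do rewrite -expr2.
  - by under eq_integral do rewrite mulr1.
  - by under eq_integral do rewrite mul1r.
  - by under eq_integral do rewrite mul1r; rewrite integral_cst// mul1e; exact: probability_setT.
have pu A B := integrable_prod_power_prob (iu A B) (ue A B).
have sumE x : (\sum_(A : {set 'I_n}) F A * \prod_(i in A) h (tnth x i)) ^+ 2 =
   \sum_(q : {set 'I_n} * {set 'I_n}) F q.1 * F q.2 * \prod_i u q.1 q.2 i (tnth x i).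
  rewrite expr2 big_distrlr pair_bigA /=; apply: eq_bigr => q _.
  rewrite [in LHS](big_mkcond (mem q.1)) [in LHS](big_mkcond (mem q.2)) /=.
  rewrite /u big_split /= /v; ring.
under eq_integral => x _ do rewrite sumE -sumEFin.
rewrite integral_sum//; last first.
  move=> q; under eq_fun do rewrite EFinM.
  by apply: integrableZl => //; exact: (pu q.1 q.2).1.
transitivity (\sum_(q : {set 'I_n} * {set 'I_n}) (F q.1 * F q.2 * (q.1 == q.2)%:R)%:E)%E.
  apply: eq_bigr => q _; under eq_integral do rewrite EFinM.
  rewrite integralZl//; last exact: (pu q.1 q.2).1.
  rewrite (pu q.1 q.2).2 -EFinM; congr (_ * _)%:E.
  have [->|/eqP AB] := eqVneq q.1 q.2; first by rewrite big1// => i _; rewrite /e eqxx.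
  have [i iAB] : exists i, (i \in q.1) != (i \in q.2).
    apply/existsP; rewrite -negb_forall; apply/negP => /forallP k.
    by apply: AB; apply/setP => i; apply/eqP; have := k i.
  by rewrite (bigD1 i)//= /e (negbTE iAB) mul0r.
rewrite sumEFin -(pair_bigA _ (fun A B => F A * F B * (A == B)%:R)) /=; congr EFin.
apply: eq_bigr => A _; rewrite (bigD1 A)//= eqxx mulr1 -expr2 big1 ?addr0// => B.
by rewrite eq_sym => /negbTE ->; rewrite mulr0.
Qed.

End PowerProb.

Lemma norm2_power_prob {d : measure_display} {T : measurableType d} {R : realType}
  (P : probability T R) n (h : T -> R) (F : {set 'I_n} -> R) (g : n.-tuple T -> R) :
  measurable_fun setT h ->
  (\int[P]_x (h x)%:E = 0)%E -> (\int[P]_x (h x ^+ 2)%:E = 1%:E)%E ->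
  (forall x, g x = \sum_(A : {set 'I_n}) F A * \prod_(i in A) h (tnth x i)) ->
  (norm2 (power_prob P n) g ^+ 2 = (sqnorm F)%:E)%E.
Proof.
move=> mh h0 h1 gE; rewrite /norm2 sqr_sqrte; last first.
  by rewrite expectation_ge0// => x; rewrite sqr_ge0.
rewrite unlock; under eq_integral do rewrite gE.
have ih2 : P.-integrable setT (fun x => (h x ^+ 2)%:E).
  apply/integrableP; split; first by apply/measurable_EFinP; exact: measurable_funX.
  under eq_integral => x _ do rewrite gee0_abs ?lee_fin ?sqr_ge0//.
  by rewrite h1 ltry.
apply: (@integral_power_prob_chaos_sq _ _ _ P n h F mh) => //.
have i1 : P.-integrable setT (EFin \o cst (1 : R)) by exact: finite_measure_integrable_cst.
have i2 := integrableD measurableT i1 ih2.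
(* Integrability of [h] comes from [|h| <= 1 + h ^+ 2]. *)
apply: (le_integrable measurableT _ _ i2); first exact/measurable_EFinP.
move=> x _ /=; rewrite lee_fin; set y := h x.
rewrite (ger0_norm (addr_ge0 ler01 (sqr_ge0 y))).
have := sqr_ge0 (y + 1); have := sqr_ge0 (y - 1).
by have := sqr_ge0 y; rewrite ler_norml sqrrB sqrrD; lra.
Qed.

(** * Norms of polynomials as Euclidean norms of coefficients *)

Section Norms.
Context {R : realType} (n : nat) (p : R).
Local Notation s := (Num.sqrt (p * (1 - p))).
Hypothesis p01 : 0 < p < 1.

Let s0 : 0 < s.
Proof. by case/andP: p01 => p0 p1; rewrite sqrtr_gt0 mulr_gt0// subr_gt0. Qed.

Let s2 : s ^+ 2 = p * (1 - p).
Proof. by rewrite sqr_sqrtr// ltW// -sqrtr_gt0. Qed.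

Variables (g : mpoly.mpoly n R) (F : {set 'I_n} -> R).
Hypothesis gF : forall v : 'I_n -> R,
  meval v g = \sum_(A : {set 'I_n}) F A * \prod_(i in A) ((v i - p) / s).

Lemma norm_gaussian_sq : (norm_gaussian p g ^+ 2 = (sqnorm F)%:E)%E.
Proof.
apply: (@norm2_power_prob _ (measurableTypeR R) R _ n (fun x => (x - p) / s)).
- exact: measurable_standardize.
- exact: normal_first_moment.
- exact: normal_second_moment.
- by move=> x; rewrite /eval_at gF.
Qed.

Lemma norm_mu_sq : (norm_mu p g ^+ 2 = (sqnorm F)%:E)%E.
Proof.
have p1 : 0 <= p <= 1 by case/andP: p01 => /ltW -> /ltW ->.
have sn0 : s != 0 by rewrite gt_eqF.
pose h (b : bool) : R := (b%:R - p) / s.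
have ib (f : bool -> R) : (bernoulli_prob p).-integrable setT (EFin \o f).
  apply/integrableP; split => //.
  rewrite (integral_bernoulli_prob p1)// -!EFinM -EFinD; exact: ltry.
apply: (@norm2_power_prob _ bool R _ n h) => //.
(* The formula for Bernoulli integrals is applied to nonnegative functions, so [h] is first shifted
   by [p / s]. *)
- have b0 (b : bool) : (0 <= (b%:R / s)%:E)%E by rewrite lee_fin divr_ge0 ?ler0n ?sqrtr_ge0.
  have := integral_bernoulli_prob p1 b0.
  rewrite (eq_integral (fun b => (h b)%:E + (p / s)%:E)%E); last first.
    by move=> b _; rewrite -EFinD /h; congr EFin; ring.
  rewrite integralD//; [|exact: ib|exact: (ib (cst (p / s)))].
  rewrite integral_cst// [X in (_ * X)%E]probability_setT mule1.
  have /fineK <- := integrable_fin_num measurableT (ib h).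
  rewrite -!EFinM -!EFinD /= mul0r mulr0 addr0 div1r => -[E]; congr EFin.
  by apply: (addIr (p / s)); rewrite add0r.
- rewrite (integral_bernoulli_prob p1) => [|b]; last by rewrite lee_fin sqr_ge0.
  rewrite -!EFinM -EFinD; congr EFin; rewrite /h /unstable.onem /=; field: s2.
  exact: sn0.
- by move=> x; rewrite /eval_at_cube gF.
Qed.

End Norms.

Theorem theorem4p3 (R : realType) :
  exists2 C : R, 0 < C &
    forall (n k d : nat) (p : R) (f ft : {mpoly R[n]}),
      (0 < n)%N ->
      0 < p <= 2^-1 ->
      p * n%:R = k%:R ->
      (d <= k <= n./2)%N ->
      multilinear f ->
      (#|occurring_vars f| <= d)%N ->
      harmonic_representative k f ft ->
      let K := C * ((d ^ 2 * 2 ^ d)%:R / (p * (1 - p) * n%:R)) in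
      (norm_mu p (f - ft)%R ^+ 2 <= K%:E * norm_mu p f ^+ 2)%E /\
      (norm_gaussian p (f - ft)%R ^+ 2 <= K%:E * norm_gaussian p f ^+ 2)%E.
Proof.
exists 80 => // n k d p f ft n0 /andP[p0 p2] pn /andP[dk kn] mlf fd [mlt ht st fft] K.
have p2' : p * 2 <= 1 by rewrite -ler_pdivlMr// mul1r.
have p1 : p < 1 by apply: le_lt_trans p2 _; rewrite invf_lt1// ltr1n.
have p01 : 0 < p < 1 by rewrite p0.
set s := Num.sqrt (p * (1 - p)).
have pp0 : 0 < p * (1 - p) by rewrite mulr_gt0// subr_gt0.
have s0 : 0 < s by rewrite sqrtr_gt0.
have s2 : s ^+ 2 = p * (1 - p) by rewrite sqr_sqrtr// ltW.
have sn0 : s != 0 by rewrite gt_eqF.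
pose F := chaos_coeff f p s; pose G := chaos_coeff ft p s.
have fF v : meval v f = \sum_(A : {set 'I_n}) F A * \prod_(i in A) ((v i - p) / s).
  exact: meval_chaos.
have tG v : meval v ft = \sum_(A : {set 'I_n}) G A * \prod_(i in A) ((v i - p) / s).
  exact: meval_chaos.
have dFG v : meval v (f - ft) =
    \sum_(A : {set 'I_n}) (F A - G A) * \prod_(i in A) ((v i - p) / s).
  by rewrite mevalB fF tG -sumrB; apply: eq_bigr => A _; rewrite mulrBl.
have kn' : (2 * k <= #|'I_n|)%N.
  by rewrite card_ord mul2n -geq_half_double.
have pn' : p * #|'I_n|%:R = k%:R by rewrite card_ord.
have n0' : (0 < #|'I_n|)%N by rewrite card_ord.
have hG : harmonic_coef G by exact: harmonic_chaos_coeff.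
have lG : coef_deg_le k G.
  move=> B; apply: chaos_coeff_msize; apply: leq_trans st _.
  by rewrite ltnS geq_minl.
have FG (X : {set 'I_n}) : #|X| = k -> chaos_sum p s F X = chaos_sum p s G X.
  move=> Xk; pose x := [tuple i \in X | i < n].
  have sx : slice k x.
    rewrite /slice /= -Xk -sum1_card [RHS]big_mkcond; apply: eq_bigr => i _.
    by rewrite tnth_mktuple; case: (i \in X).
  have := fft x sx; rewrite /eval_at_cube fF tG.
  under eq_bigr => A _ do under eq_bigr => i _ do rewrite tnth_mktuple.
  by under [X in _ = X -> _]eq_bigr => A _ do under eq_bigr => i _ do rewrite tnth_mktuple.
have FS (A : {set 'I_n}) : ~~ (A \subset occurring_vars f) -> F A = 0.
  exact: chaos_coeff_occurring.
have main : sqnorm (fun A => F A - G A) <= K * sqnorm F.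
  (* The bound holds with the exact number of occurring variables and increases to the one with
     [d]. *)
  have := dist_harmonic_representative p0 p2' s0 s2 pn' kn' n0' hG lG FG FS (leq_trans fd dk).
  move=> h; apply: (le_trans h); rewrite card_ord ler_wpM2r ?sqnorm_ge0// ler_wpM2l//.
  rewrite ler_wpM2r ?invr_ge0 ?mulr_ge0 ?(ltW p0) ?subr_ge0 ?(ltW p1)// ler_nat.
  by rewrite leq_mul// ?leq_sqr// leq_pexp2l.
split.
  by rewrite (norm_mu_sq p01 dFG) (norm_mu_sq p01 fF) -EFinM lee_fin.
by rewrite (norm_gaussian_sq p01 dFG) (norm_gaussian_sq p01 fF) -EFinM lee_fin.
Qed.
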